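(* Let $V$ be an irreducible normal simply connected algebraic variety over an algebraically closed field $\mathbb{K}$. If the characteristic of $\mathbb{K}$ is $0$ or if the divisor class group of $V$ is trivial, then any invertible regular function on $V$ is constant.
   Context: Simply connected is meant in the algebraic sense: every finite étale covering $W\to V$ with $W$ an irreducible variety is an isomorphism. (When $\mathbb{K}=\mathbb{C}$, this holds in particular if $V$ is simply connected in the classical topology.) *)

(* Defs.v *)
From HB Require Import structures.
From mathcomp Require Import all_boot all_order all_algebra.
From mathcomp Require Import mpoly.
From mathcomp Require Import boolp classical_sets functions cardinality.
From mathcomp Require Import filter topology.

Set Implicit Arguments.
Unset Strict Implicit.
Unset Printing Implicit Defensive.

Import GRing.Theory.
Local Open Scope classical_set_scope.
Local Open Scope ring_scope.
Local Open Scope quotient_scope.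

(* Varieties are classical: the points are the closed points, and the structure
   sheaf is a sheaf of K-valued functions.  [reg U f] says that the restriction
   of [f] to the open set [U] is a section over [U]; by [reg_ext] the values of
   [f] outside [U] are irrelevant, and [reg U] is only meaningful for open
   [U]. *)
Record funSpace (K : closedFieldType) := FunSpace {
  carrier :> topologicalType;
  reg : set carrier -> (carrier -> K) -> Prop;
  reg_ext : forall U f g, {in U, f =1 g} -> reg U f -> reg U g;
  reg_restr : forall U U' f, open U -> open U' -> U' `<=` U ->
    reg U f -> reg U' f;
  reg_glue : forall (C : set (set carrier)) f,
    (forall U, C U -> open U /\ reg U f) -> reg (\bigcup_(U in C) U) f;
  reg_cst : forall U c, open U -> reg U (fun=> c);
  reg_add : forall U f g, open U -> reg U f -> reg U g ->
    reg U (fun x => f x + g x);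
  reg_mul : forall U f g, open U -> reg U f -> reg U g ->
    reg U (fun x => f x * g x) }.
Arguments reg {K X} U f : rename.

Definition irreducible (T : topologicalType) (Z : set T) :=
  Z !=set0 /\ forall A B, closed A -> closed B ->
    Z `<=` A `|` B -> Z `<=` A \/ Z `<=` B.

Section Morphisms.
Context {K : closedFieldType}.

Record morphism (X Y : funSpace K) := Morphism {
  mfun :> X -> Y;
  mfun_cont : continuous mfun;
  mfun_reg : forall U g, open U -> reg U g -> reg (mfun @^-1` U) (g \o mfun) }.

Definition is_isomorphism (X Y : funSpace K) (phi : morphism X Y) :=
  exists psi : morphism Y X, cancel phi psi /\ cancel psi phi.

End Morphisms.

Section Varieties.
Context {K : closedFieldType}.

Definition algebraic_set n (A : set ('I_n -> K)) :=
  exists S : set {mpoly K[n]}, A = [set v | forall p, S p -> p.@[v] = 0].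

(* [U] is isomorphic, through the chart [phi], to a Zariski closed subset of
   K^n equipped with its regular functions (locally quotients of
   polynomials). *)
Definition affine_open (X : funSpace K) (U : set X) :=
  open U /\ exists n (phi : X -> 'I_n -> K),
    [/\ {in U &, injective phi},
        algebraic_set (phi @` U),
        forall U', U' `<=` U ->
          open U' <-> exists2 A, algebraic_set A & U' = U `\` phi @^-1` A
      & forall U' f, open U' -> U' `<=` U ->
          reg U' f <-> forall x, U' x ->
            exists N (p q : {mpoly K[n]}), [/\ open_nbhs x N, N `<=` U'
              & forall y, N y ->
                  q.@[phi y] != 0 /\ f y = p.@[phi y] / q.@[phi y]] ].

(* Two morphisms from an affine variety agree on a closed set; equivalent to the
   diagonal being closed in the product variety. *)
Definition separated (X : funSpace K) :=
  forall (Z : funSpace K) (f g : morphism Z X), affine_open [set: Z] ->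
    closed [set z | f z = g z].

Definition variety (X : funSpace K) :=
  (exists m (U : 'I_m -> set X),
     (forall i, affine_open (U i)) /\ \bigcup_i U i = [set: X])
  /\ separated X.

End Varieties.

Section Stalk.
Context {K : closedFieldType} {X : funSpace K}.
Variable x : X.

Definition regular_at : {pred X -> K} :=
  [pred f | `[< exists2 U, open_nbhs x U & reg U f >]].

Lemma regular_atP (f : X -> K) :
  reflect (exists2 U, open_nbhs x U & reg U f) (f \in regular_at).
Proof. exact: asboolP. Qed.

Fact regular_at_cst (c : K) : (fun=> c) \in regular_at.
Proof.
apply/regular_atP; exists setT; first by split => //; exact: openT.
by apply: reg_cst; exact: openT.
Qed.

Fact regular_at_op (op : K -> K -> K) (f g : X -> K) :
  (forall (U : set X) f g, open U -> reg U f -> reg U g ->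
     reg U (fun y => op (f y) (g y))) ->
  f \in regular_at -> g \in regular_at ->
  (fun y => op (f y) (g y)) \in regular_at.
Proof.
move=> opP /regular_atP[U [oU Ux] Uf] /regular_atP[V [oV Vx] Vg].
have oUV : open (U `&` V) by exact: openI.
apply/regular_atP; exists (U `&` V); first by split.
by apply: opP => //; [apply: reg_restr Uf | apply: reg_restr Vg] => //;
   move=> y [].
Qed.

Fact regular_at_subring : subring_closed regular_at.
Proof.
split=> [|f g fr gr|f g fr gr]; first exact: regular_at_cst.
- apply: (regular_at_op (@reg_add _ X)) => //.
  have -> : - g = (fun y => -1 * g y) by apply/funext => y; rewrite mulN1r.
  exact: (regular_at_op (@reg_mul _ X) (regular_at_cst _) gr).
- exact: (regular_at_op (@reg_mul _ X)).
Qed.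
HB.instance Definition _ :=
  GRing.isSubringClosed.Build _ regular_at regular_at_subring.

Record local_fun := LocalFun { lfun :> X -> K; lfunP : lfun \in regular_at }.
HB.instance Definition _ := [isSub for lfun].
HB.instance Definition _ := [Choice of local_fun by <:].
HB.instance Definition _ := GRing.SubChoice_isSubComPzRing.Build (X -> K)
  regular_at local_fun regular_at_subring.

Lemma lfun1 (y : X) : (1 : local_fun) y = 1.
Proof. by []. Qed.

Lemma lfun0 (y : X) : (0 : local_fun) y = 0.
Proof. by []. Qed.

Lemma lfunD (f g : local_fun) (y : X) : (f + g) y = f y + g y.
Proof. by []. Qed.

Lemma lfunB (f g : local_fun) (y : X) : (f - g) y = f y - g y.
Proof. by []. Qed.

Lemma lfunM (f g : local_fun) (y : X) : (f * g) y = f y * g y.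
Proof. by []. Qed.

Fact local_fun_oner_neq0 : (1 : local_fun) != 0.
Proof.
apply/eqP => /(congr1 (fun f : local_fun => f x)).
by rewrite lfun1 lfun0; apply/eqP; exact: oner_neq0.
Qed.
HB.instance Definition _ :=
  GRing.PzSemiRing_isNonZero.Build local_fun local_fun_oner_neq0.

Definition null_germ : {pred local_fun} :=
  [pred f : local_fun | `[< \forall y \near x, f y = 0 >]].

Fact null_germ_ideal : idealr_closed null_germ.
Proof.
split.
- by apply/asboolP; near=> y; rewrite lfun0.
- apply/asboolP => /nbhs_singleton; rewrite lfun1.
  by apply/eqP; exact: oner_neq0.
- move=> a f g /asboolP f0 /asboolP g0; apply/asboolP.
  near=> y; rewrite lfunD lfunM.
  have -> : f y = 0 by near: y.
  have -> : g y = 0 by near: y.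
  by rewrite mulr0 addr0.
Unshelve. all: by end_near. Qed.
HB.instance Definition _ := isIdealr.Build _ null_germ null_germ_ideal.

Definition stalk := {ideal_quot null_germ}.
HB.instance Definition _ := GRing.ComNzRing.on stalk.
HB.instance Definition _ := EqQuotient.on stalk.

Definition germ (f : local_fun) : stalk := \pi_stalk f.

Lemma germE (f g : local_fun) :
  germ f = germ g <-> \forall y \near x, f y = g y.
Proof.
rewrite /germ; split.
- move=> /eqP; rewrite -Quotient.idealrBE => /asboolP.
  by apply: filterS => y /eqP; rewrite lfunB subr_eq0 => /eqP.
- move=> fg; apply/eqP; rewrite -Quotient.idealrBE; apply/asboolP.
  by apply: filterS fg => y fgy; rewrite lfunB fgy subrr.
Qed.

Definition max_ideal : set stalk :=
  [set a | exists2 f : local_fun, f x = 0 & a = germ f].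
End Stalk.

Arguments stalk {K X} x.
Arguments germ {K X x} f.
Arguments max_ideal {K X} x.

Section Pullback.
Context {K : closedFieldType} {X Y : funSpace K}.
Variables (phi : morphism X Y) (x : X).

Fact comp_regular_at (f : local_fun (phi x)) : f \o phi \in regular_at x.
Proof.
have /regular_atP[U [oU Ux] Uf] := lfunP f.
apply/regular_atP; exists (phi @^-1` U); last exact: mfun_reg.
by split => //; apply: (proj1 (continuousP phi)) => //; exact: mfun_cont.
Qed.

Definition lfun_comp (f : local_fun (phi x)) : local_fun x :=
  LocalFun (comp_regular_at f).

Definition pullback (a : stalk (phi x)) : stalk x := germ (lfun_comp (repr a)).

Lemma pullback_germ (f : local_fun (phi x)) :
  pullback (germ f) = germ (lfun_comp f).
Proof.
have near_f : \forall z \near phi x, repr (germ f) z = f z.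
  by apply/germE; rewrite /germ reprK.
by apply/germE; exact: (@mfun_cont _ _ _ phi x _ near_f).
Qed.

Fact pullback_is_zmod_morphism : zmod_morphism pullback.
Proof.
move=> a b; rewrite -[a]reprK -[b]reprK -/(germ _) -/(germ _).
rewrite /germ -rmorphB -!/(germ _) !pullback_germ /germ -rmorphB -!/(germ _).
by congr germ; apply/val_inj/funext.
Qed.

Fact pullback_is_monoid_morphism : monoid_morphism pullback.
Proof.
split=> [|a b].
  rewrite -(rmorph1 (\pi_(stalk (phi x)))) -/(germ _) pullback_germ.
  rewrite -(rmorph1 (\pi_(stalk x))) -/(germ _).
  by congr germ; apply/val_inj/funext.
rewrite -[a]reprK -[b]reprK -/(germ _) -/(germ _).
rewrite /germ -rmorphM -!/(germ _) !pullback_germ /germ -rmorphM -!/(germ _).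
by congr germ; apply/val_inj/funext.
Qed.

HB.instance Definition _ := GRing.isZmodMorphism.Build
  (stalk (phi x)) (stalk x) pullback pullback_is_zmod_morphism.
HB.instance Definition _ := GRing.isMonoidMorphism.Build
  (stalk (phi x)) (stalk x) pullback pullback_is_monoid_morphism.
End Pullback.

Arguments pullback {K X Y} phi x a.

Section Algebra.
Variables (A B : comNzRingType) (h : {rmorphism A -> B}).

Definition balanced (M : lmodType A) (P : zmodType) (beta : M -> B -> P) :=
  [/\ forall b, {morph beta^~ b : m m' / m + m'},
      forall m, {morph beta m : b b' / b + b'}
    & forall a m b, beta (a *: m) b = beta m (h a * b)].

(* The class of the formal sum [s] of elementary tensors vanishes in the tensor
   product of [M] and [B] over [A]; the tensor product is only accessed through
   its universal property. *)
Definition tensor_zero (M : lmodType A) (s : seq (M * B)) :=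
  forall (P : zmodType) (beta : M -> B -> P), balanced beta ->
    \sum_(p <- s) beta p.1 p.2 = 0.

(* - ⊗_A B preserves injections. *)
Definition flat := forall (M N : lmodType A) (u : {linear M -> N}),
  injective u -> forall s : seq (M * B),
    tensor_zero [seq (u p.1, p.2) | p <- s] -> tensor_zero s.

End Algebra.

Definition normal_domain (A : comNzRingType) :=
  exists (D : idomainType) (e : {rmorphism A -> D}), bijective e /\
    forall z : {fraction D}, integralOver (@tofrac D) z ->
      exists d : D, z = tofrac d.

Section Coverings.
Context {K : closedFieldType}.

Definition normal (X : funSpace K) := forall x : X, normal_domain (stalk x).

(* Every point of the base has an affine neighbourhood [U] with affine preimage
   such that O(phi^-1 U) is a finitely generated O(U)-module. *)
Definition finite_morphism (X Y : funSpace K) (phi : morphism X Y) :=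
  forall y : Y, exists U : set Y,
    [/\ U y, affine_open U, affine_open (phi @^-1` U)
      & exists n (g : 'I_n -> X -> K),
          (forall i, reg (phi @^-1` U) (g i)) /\
          forall h, reg (phi @^-1` U) h ->
            exists2 a : 'I_n -> Y -> K, (forall i, reg U (a i))
              & forall x, U (phi x) -> h x = \sum_i a i (phi x) * g i x].

(* The maximal ideal of O_{Y,phi x} generates that of O_{X,x}; both residue
   fields are K, so the residue field extension is trivially separable. *)
Definition unramified_at (X Y : funSpace K) (phi : morphism X Y) (x : X) :=
  forall b, max_ideal x b ->
    exists n (c : 'I_n -> stalk x) (a : 'I_n -> stalk (phi x)),
      (forall i, max_ideal (phi x) (a i)) /\ b = \sum_i c i * pullback phi x (a i).

(* It suffices to look at closed points, the étale locus being open. *)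
Definition etale (X Y : funSpace K) (phi : morphism X Y) :=
  forall x : X, flat (pullback phi x) /\ unramified_at phi x.

(* For irreducible [W] and [V] a finite étale morphism is automatically
   surjective, its image being nonempty, open and closed. *)
Definition simply_connected (V : funSpace K) :=
  forall (W : funSpace K) (phi : morphism W V),
    variety W -> irreducible [set: W] -> finite_morphism phi -> etale phi ->
    is_isomorphism phi.

End Coverings.

Section Divisors.
Context {K : closedFieldType}.
Variable X : funSpace K.
Implicit Types (D Z : set X) (f g t u : X -> K).

(* For irreducible [X], the last two conditions say that [D] has codimension
   one. *)
Definition prime_divisor D :=
  [/\ closed D, irreducible D, D <> setT
    & forall Z, closed Z -> irreducible Z -> D `<=` Z -> Z = D \/ Z = setT].

(* For [Z] irreducible: [P] holds in a neighbourhood of the generic point of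
   [Z].  The local ring O_{X,Z} consists of the functions regular along [Z], up
   to equality generically on [Z]; for [Z = setT] it is the function field. *)
Definition generically Z (P : X -> Prop) :=
  exists U, [/\ open U, U `&` Z !=set0 & U `<=` P].

Definition regular_along Z f :=
  exists U, [/\ open U, U `&` Z !=set0 & reg U f].

Definition unit_along Z u := regular_along Z u /\
  exists2 v, regular_along Z v & generically Z (fun x => u x * v x = 1).

Definition vanishes_along Z f := generically Z (fun x => Z x -> f x = 0).

(* [t] generates the maximal ideal of O_{X,D}. *)
Definition uniformizer D t :=
  [/\ regular_along D t, vanishes_along D t
    & forall g, regular_along D g -> vanishes_along D g ->
        exists2 h, regular_along D h & generically D (fun x => g x = h x * t x)].

(* The valuation of the rational function [f] along the prime divisor [D];
   O_{X,D} is a discrete valuation ring when X is normal. *)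
Definition ord_along D f (n : int) :=
  exists t u, [/\ uniformizer D t, unit_along D u
    & generically setT (fun x => f x = u x * t x ^ n)].

(* A Weil divisor is given by its coefficients; only the values at prime
   divisors matter. *)
Definition weil_divisor (c : set X -> int) :=
  finite_set [set D | prime_divisor D /\ c D != 0].

Definition principal (c : set X -> int) :=
  exists f, [/\ regular_along setT f, generically setT (fun x => f x != 0)
    & forall D, prime_divisor D -> ord_along D f (c D)].

Definition trivial_class_group := forall c, weil_divisor c -> principal c.

Definition invertible_regular f := reg setT f /\
  exists2 g, reg setT g & forall x, f x * g x = 1.

Definition constant_function f := exists c : K, forall x, f x = c.

End Divisors.

(* Main.v *)
Require Import Defs.
From HB Require Import structures.
From mathcomp Require Import all_boot all_order all_algebra all_solvable all_field.
From mathcomp Require Import mpoly.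
From mathcomp Require Import ring.
From mathcomp Require Import boolp classical_sets functions topology.

Set Implicit Arguments.
Unset Strict Implicit.
Unset Printing Implicit Defensive.

Import GRing.Theory.

(** A nonconstant invertible regular function [f] on [V] would be infinitely
    divisible in the multiplicative group of the function field of [V], which
    is impossible because that field is finitely generated over [K].

    Divisibility.  Let [l] be 2 or 3, nonzero in [K].  The covering
    W = {(v, t) | t^l = f v} of [V] is again a variety; it is finite over [V]
    ([cover_finite]) and étale ([cover_etale]), since locally on [V] its
    coordinate ring is O(V)[t] / (t^l - f) and both [l] and [f] are units.  Its
    fibres have [l] points, so it is not an isomorphism ([nontrivial_cover]).
    As [V] is simply connected, W is therefore reducible, which forces the
    polynomial X^l - f to be reducible over the function field
    ([poly_fun_domain], [cover_irreducible]).  Its degree being at most 3, it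
    has a root there, and since [V] is normal this root is an everywhere regular
    function ([rational_root]).  Hence every invertible regular function is the
    [l]-th power of another one ([regular_root]).

    Non-divisibility.  Let [F] be the function field.  If [f] is not in [K], it
    is transcendental over [K], as [K] is algebraically closed.  Minus the order
    at infinity is a homomorphism K(f)^* -> Z which does not kill [f], and it
    can be extended along the generators of [F] one at a time: through leading
    coefficients at a transcendental generator, through the norm, up to a
    nonzero integer factor, at an algebraic one.  This yields a homomorphism
    v : F^* -> Z with v(f) != 0 ([function_field_hom]).  If [f] is the [l]-th
    power of [g], the absolute value of v(g) is smaller than that of v(f) and
    still nonzero, and iterating gives an infinite descent
    ([invertible_constant]).

    Rational functions are handled inside the fraction field of the local ring
    at one point, which normality makes a domain; density of nonempty open sets
    carries the results to the other points. *)

(** * Flatness of a localisation of a free algebra *)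

Section EventuallyZero.
Local Open Scope ring_scope.
Variables (B : comNzRingType) (S : B -> Prop) (Z : zmodType).
Hypotheses (S1 : S 1) (SM : forall s s', S s -> S s' -> S (s * s')).

(** Quotienting the functions B -> Z by this subgroup replaces a localisation of
    a module: n / s is represented by the function sending t to (t / s) n for the
    multiples t of s, which are all that matters up to functions vanishing on
    the multiples of some element of S.  No fraction of module elements has to
    be built. *)
Definition eventually_zero : {pred (B -> Z)} :=
  [pred phi | `[< exists2 s0, S s0 & forall s, S s -> phi (s * s0) = 0 >]].

Fact eventually_zero_zmod_closed : zmod_closed eventually_zero.
Proof.
split=> [|phi psi /asboolP[s0 Ss0 phi0] /asboolP[s1 Ss1 psi0]].
  by apply/asboolP; exists 1.
apply/asboolP; exists (s0 * s1); first exact: SM.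
move=> s Ss; rewrite [LHS]/(phi _ - psi _).
have -> : phi (s * (s0 * s1)) = 0 by rewrite mulrCA mulrC phi0 //; exact: SM.
have -> : psi (s * (s0 * s1)) = 0 by rewrite mulrA psi0 //; exact: SM.
exact: subrr.
Qed.

End EventuallyZero.

Section FlatLocalisation.
Local Open Scope ring_scope.
Variables (A B : comNzRingType) (h : {rmorphism A -> B}) (l : nat).
Variable e : 'I_l -> B.

Definition in_span b := exists a : 'I_l -> A, b = \sum_k h (a k) * e k.

Hypothesis e_free : forall a : 'I_l -> A,
  \sum_k h (a k) * e k = 0 -> forall k, a k = 0.
Hypothesis span1 : in_span 1.
Hypothesis spanM : forall b b', in_span b -> in_span b' -> in_span (b * b').
Hypothesis span_denominator : forall b,
  exists c c', [/\ in_span c, c * c' = 1 & in_span (c * b)].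

Let span_e k : in_span (e k).
Proof.
exists (fun i => (i == k)%:R); rewrite (bigD1 k) //= eqxx rmorph1 mul1r.
by rewrite big1 ?addr0 // => i /negPf->; rewrite rmorph0 mul0r.
Qed.

Let coord b : 'I_l -> A :=
  if pselect (in_span b) is left P then projT1 (cid P) else 0.

Let coordP b : in_span b -> b = \sum_k h (coord b k) * e k.
Proof. by move=> sb; rewrite /coord; case: pselect => // P; exact: projT2 (cid P). Qed.

Let coord_uniq b a : b = \sum_k h (a k) * e k -> coord b = a.
Proof.
move=> ba; have sb : in_span b by exists a.
apply/funext => k; apply/eqP; rewrite -subr_eq0.
apply/eqP; apply: (e_free (a := fun k => coord b k - a k)).
under eq_bigr do rewrite rmorphB mulrBl.
by rewrite sumrB -coordP // -ba subrr.
Qed.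

Let coordD b b' : in_span b -> in_span b' ->
  coord (b + b') = fun k => coord b k + coord b' k.
Proof.
move=> sb sb'; apply: coord_uniq; rewrite {1}(coordP sb) {1}(coordP sb').
by rewrite -big_split /=; apply: eq_bigr => k _; rewrite rmorphD mulrDl.
Qed.

Let coordZ a b : in_span b -> coord (h a * b) = fun k => a * coord b k.
Proof.
move=> sb; apply: coord_uniq; rewrite {1}(coordP sb) mulr_sumr.
by apply: eq_bigr => k _; rewrite rmorphM mulrA.
Qed.

Let S b := in_span b /\ exists b', b * b' = 1.

Let S1 : S 1. Proof. by split=> //; exists 1; rewrite mulr1. Qed.

Let SM b b' : S b -> S b' -> S (b * b').
Proof.
move=> [sb [c bc]] [sb' [c' bc']]; split; first exact: spanM.
by exists (c * c'); rewrite mulrACA bc bc' mulr1.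
Qed.

Lemma balanced_span (M : lmodType A) (P : zmodType) (beta : M -> B -> P) m b y :
  balanced h beta -> in_span b ->
  beta m (b * y) = \sum_k beta (coord b k *: m) (e k * y).
Proof.
case=> _ betaDr betaZ /coordP {1}->.
have beta0 n : beta n 0 = 0.
  by apply: (addrI (beta n 0)); rewrite addr0 -betaDr addr0.
rewrite mulr_suml (big_morph (beta m) (betaDr m) (beta0 m)).
by apply: eq_bigr => k _; rewrite betaZ mulrA.
Qed.

Let balanced_sum (M : lmodType A) (P : zmodType) (beta : M -> B -> P)
    (I : finType) (m : I -> M) b :
  balanced h beta -> beta (\sum_i m i) b = \sum_i beta (m i) b.
Proof.
case=> betaDl _ _; apply: (big_morph (beta^~ b) (betaDl b)).
by apply: (addrI (beta 0 b)); rewrite addr0 -betaDl addr0.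
Qed.

(* A tensor with denominator 1 / q' is rewritten with denominator q' c', by
   expanding c * e k on the basis. *)
Let change_den (M : lmodType A) (m : 'I_l -> M) q' c c' :
  in_span c -> c * c' = 1 ->
  forall (P : zmodType) (beta : M -> B -> P), balanced h beta ->
  \sum_k beta (m k) (e k * q') =
  \sum_j beta (\sum_k coord (c * e k) j *: m k) (e j * (q' * c')).
Proof.
move=> sc cc P beta bal.
under [RHS]eq_bigr do rewrite balanced_sum //.
rewrite exchange_big /=; apply: eq_bigr => k _.
rewrite -balanced_span //; last by apply: spanM => //; exact: span_e.
congr beta; rewrite -[LHS]mulr1 -cc; ring.
Qed.

(** As the elements of [s] have finitely many denominators, the sum of tensors
    that [s] stands for is a combination of the basis over a single
    denominator. *)
Lemma common_denominator (M : lmodType A) (s : seq (M * B)) :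
  exists q q' (m : 'I_l -> M), [/\ in_span q, q * q' = 1 &
    forall (P : zmodType) (beta : M -> B -> P), balanced h beta ->
      \sum_(p <- s) beta p.1 p.2 = \sum_k beta (m k) (e k * q')].
Proof.
elim: s => [|[m0 b] s [q [q' [m [sq qq IH]]]]].
  exists 1, 1, (fun=> 0); split=> //; first by rewrite mulr1.
  move=> P beta [betaD _ _]; rewrite big_nil big1 // => k _.
  by apply: (addrI (beta 0 (e k * 1))); rewrite addr0 -betaD addr0.
have [c [c' [sc cc scb]]] := span_denominator b.
exists (q * c), (q' * c').
exists (fun j => coord (q * (c * b)) j *: m0 + \sum_k coord (c * e k) j *: m k).
split; first exact: spanM.
  by rewrite mulrACA qq cc mulr1.
move=> P beta bal; rewrite big_cons IH //= (change_den _ _ sc cc) //.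
have -> : b = q * (c * b) * (q' * c').
  by transitivity (q * q' * (c * c') * b); [rewrite qq cc !mul1r | ring].
rewrite (balanced_span _ _ bal); last exact: spanM.
rewrite -big_split /=; apply: eq_bigr => j _.
have [betaD _ _] := bal; rewrite betaD; congr (_ + _).
congr beta; congr (coord _ _ *: _).
by transitivity (q * q' * (c * c') * (q * (c * b))); [rewrite qq cc !mul1r | ring].
Qed.

(** If [B] is a localisation of a subalgebra which is free over [A], then [B] is
    flat.  Let [u] be injective and let the image under [u] of a tensor [s]
    vanish.  Pairing it with the balanced map to the localisation of N^l shows
    that, for the tensor \sum_k m_k ⊗ (e_k / q) equal to [s], the vector
    (u m_k) is killed by some s0 invertible in [B].  As [u] is injective, s0
    kills (m_k) as well, hence [s] vanishes. *)
Lemma flat_of_localized_basis : flat h.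
Proof.
move=> M N u u_inj s su0.
have [q [q' [m [sq qq sE]]]] := common_denominator s.
pose Z : zmodType := 'I_l -> N.
pose I0 : {pred (B -> Z)} := @eventually_zero B S Z.
pose Ic := GRing.isZmodClosed.Build (B -> Z) I0 (eventually_zero_zmod_closed Z S1 SM).
pose I : zmodClosed (B -> Z) := HB.pack I0 Ic.
pose Q : zmodType := {ideal_quot I}.
pose beta0 (n : N) (b : B) : B -> Z := fun s j => coord (s * b) j *: n.
pose pi (x : B -> Z) : Q := (\pi_({ideal_quot I}) x)%qT.
pose beta (n : N) (b : B) : Q := pi (beta0 n b).
have piE (x y : B -> Z) : (exists2 s0, S s0 & forall s, S s -> x (s * s0) = y (s * s0)) ->
    pi x = pi y.
  case=> s0 Ss0 xy; apply/eqP; rewrite -Quotient.idealrBE; apply/asboolP.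
  exists s0 => // t St.
  have : x (t * s0) - y (t * s0) = 0 by rewrite xy // subrr.
  exact: id.
have piD (x y : B -> Z) : pi (x + y) = pi x + pi y :> Q.
  exact: Quotient.pi_add.
have pi0 : pi 0 = 0 by apply: (addrI (pi 0)); rewrite addr0 -piD addr0.
have Sden b : exists2 s0, S s0 & forall t, S t -> in_span (t * s0 * b).
  have [c [c' [sc cc scb]]] := span_denominator b.
  exists c => [|t [st _]]; first by split=> //; exists c'.
  by rewrite -mulrA; exact: spanM.
have bal : balanced h beta.
  split=> [b n n'|n b b'|a n b].
  - by rewrite -piD; congr pi; apply/funext => t; apply/funext => j;
      exact: scalerDr.
  - rewrite -piD; apply: piE.
    have [c [sc [ci cc]] cb] := Sden b; have [d [sd [di dd]] db'] := Sden b'.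
    exists (c * d) => [|t St]; first by apply: SM; split=> //; [exists ci | exists di].
    apply/funext => j; rewrite [RHS]/(_ + _) /beta0.
    have tb : in_span (t * (c * d) * b).
      rewrite (_ : _ * b = t * d * c * b); last by ring.
      by apply: cb; apply: SM => //; split => //; exists di.
    have tb' : in_span (t * (c * d) * b').
      by rewrite mulrA; apply: db'; apply: SM => //; split => //; exists ci.
    by rewrite mulrDr coordD // scalerDl.
  - apply: piE; have [c Sc cb] := Sden b; exists c => // t St.
    apply/funext => j; rewrite /beta0 mulrCA coordZ; last exact: cb.
    by rewrite scalerA mulrC.
have balu : balanced h (fun m b => beta (u m) b).
  have [bD1 bD2 bZ] := bal.
  split=> [b x y|x b b'|a x b]; first by rewrite linearD bD1.
    exact: bD2.
  by rewrite linearZ bZ.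
have := su0 Q beta bal; rewrite big_map /= (sE _ _ balu).
have -> : \sum_k beta (u (m k)) (e k * q') =
    pi (\sum_k beta0 (u (m k)) (e k * q')) :> Q.
  by rewrite (big_morph _ piD pi0).
move=> sum0; have [s0 [ss0 [s0' ss0']] s00] : exists2 s0, S s0 & forall t, S t ->
    (\sum_k beta0 (u (m k)) (e k * q')) (t * s0) = 0.
  have : pi (\sum_k beta0 (u (m k)) (e k * q')) == pi 0.
    by rewrite pi0; apply/eqP.
  by rewrite -Quotient.idealrBE subr0 => /asboolP.
have m0 j : \sum_k coord (s0 * e k) j *: m k = 0.
  apply: u_inj; rewrite raddf0 raddf_sum /=.
  have /s00/(congr1 (@^~ j)) qs0 : S q by split=> //; exists q'.
  transitivity ((\sum_k beta0 (u (m k)) (e k * q')) (q * s0) j); last exact: qs0.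
  rewrite !fct_sumE; apply: eq_bigr => k _; rewrite linearZ /beta0.
  congr (coord _ _ *: _).
  by transitivity (q * q' * (s0 * e k)); [rewrite qq mul1r | ring].
move=> P bt btbal; rewrite sE // (change_den _ _ ss0 ss0') // big1 // => j _.
rewrite m0; case: btbal => btD _ _.
by apply: (addrI (bt 0 (e j * (q' * s0')))); rewrite addr0 -btD addr0.
Qed.
End FlatLocalisation.

(** * Homomorphisms from the multiplicative group of a function field to Z *)

Section Adjoin.
Local Open Scope ring_scope.

(** A homomorphism from the multiplicative group of [F] to the integers; the
    value at 0 is arbitrary. *)
Definition mul_to_add (F : fieldType) (v : F -> int) :=
  forall x y, x != 0 -> y != 0 -> v (x * y) = v x + v y.

Variables (L F : fieldType) (j : {rmorphism L -> F}) (a : F).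
Local Notation ev p := (map_poly j p).[a].

(** The subfield L(a) of [F]. *)
Definition adjoin : {pred F} :=
  [pred y | `[< exists p q, ev q != 0 /\ y = ev p / ev q >]].

Fact adjoin_divring_closed : divring_closed adjoin.
Proof.
split.
- by apply/asboolP; exists 1, 1; rewrite rmorph1 hornerC oner_neq0 divr1.
- move=> _ _ /asboolP[p [q [q0 ->]]] /asboolP[r [s [s0 ->]]].
  apply/asboolP; exists (p * s - r * q), (q * s).
  rewrite rmorphB !rmorphM /= hornerD hornerN !hornerM mulf_neq0 //; split=> //.
  by field; rewrite q0 s0.
- move=> _ _ /asboolP[p [q [q0 ->]]] /asboolP[r [s [s0 ->]]].
  apply/asboolP; have [r0|r0] := eqVneq (ev r) 0.
    exists 0, 1; rewrite rmorph1 hornerC oner_neq0 r0 rmorph0 horner0.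
    by rewrite !mul0r invr0 mulr0.
  exists (p * s), (q * r); rewrite !rmorphM /= !hornerM mulf_neq0 //; split=> //.
  by field; rewrite q0 s0 r0.
Qed.
HB.instance Definition _ :=
  GRing.isDivringClosed.Build F adjoin adjoin_divring_closed.

Record adjoin_field := AdjoinField { adjoin_val : F; _ : adjoin_val \in adjoin }.
HB.instance Definition _ := [isSub for adjoin_val].
HB.instance Definition _ := [Choice of adjoin_field by <:].
HB.instance Definition _ := [SubChoice_isSubIntegralDomain of adjoin_field by <:].
HB.instance Definition _ := [SubIntegralDomain_isSubField of adjoin_field by <:].

Definition adjoin_inj : {rmorphism adjoin_field -> F} := val.

Lemma mem_adjoin p : ev p \in adjoin.
Proof. by apply/asboolP; exists p, 1; rewrite rmorph1 hornerC oner_neq0 divr1. Qed.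

(** A homomorphism on L(a) amounts to a function [nu] of the polynomials over
    [L] which is additive on products and only depends on the value at [a]:
    a quotient p(a) / q(a) is sent to nu p - nu q. *)
Lemma adjoin_hom (nu : {poly L} -> int) :
  (forall p q, ev p != 0 -> ev q != 0 -> nu (p * q) = nu p + nu q) ->
  (forall p q, ev p = ev q -> ev p != 0 -> nu p = nu q) ->
  exists2 v : adjoin_field -> int, mul_to_add v &
    forall p y, adjoin_inj y = ev p -> y != 0 -> v y = nu p.
Proof.
move=> nuM nuE.
have rep (y : adjoin_field) : exists pq, ev pq.2 != 0 /\ val y = ev pq.1 / ev pq.2.
  by case: y => y /= /asboolP[p [q pq]]; exists (p, q).
pose num y := (projT1 (cid (rep y))).1; pose den y := (projT1 (cid (rep y))).2.
have den0 y : ev (den y) != 0 by have [] := projT2 (cid (rep y)).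
have numE y : ev (num y) = val y * ev (den y).
  by have [d0 /= ->] := projT2 (cid (rep y)); rewrite divfK.
have val0 (y : adjoin_field) : y != 0 -> val y != 0 by rewrite (inj_eq val_inj y 0).
have num0 y : y != 0 -> ev (num y) != 0.
  by move=> /val0 y0; rewrite numE mulf_neq0.
exists (fun y => nu (num y) - nu (den y)) => [x y x0 y0|p y yp y0].
  have xy0 : x * y != 0 by rewrite mulf_neq0.
  apply/eqP; rewrite -(inj_eq (addrI (nu (den (x * y)) + (nu (den x) + nu (den y))))).
  have -> : nu (den (x * y)) + (nu (den x) + nu (den y)) +
      (nu (num (x * y)) - nu (den (x * y))) = nu (num (x * y)) + nu (den x) + nu (den y).
    ring.
  have -> : nu (den (x * y)) + (nu (den x) + nu (den y)) +
      (nu (num x) - nu (den x) + (nu (num y) - nu (den y))) =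
      nu (num x) + nu (num y) + nu (den (x * y)) by ring.
  have n0 := num0; have d0 := den0; have M0 := mulf_neq0.
  have evM p q : ev (p * q) = ev p * ev q by rewrite rmorphM hornerM.
  rewrite -nuM ?n0 // -nuM ?evM ?M0 ?n0 // -nuM ?n0 // -nuM ?evM ?M0 ?n0 //.
  apply/eqP/nuE; rewrite ?evM ?M0 ?n0 // !numE rmorphM /=; ring.
have p0 : ev p != 0 by rewrite -yp; exact: val0.
apply/eqP; rewrite subr_eq -(nuM _ _ p0 (den0 y)); apply/eqP/nuE; last exact: num0.
by rewrite numE [map_poly j (p * _)]rmorphM hornerM -yp.
Qed.
End Adjoin.

Section ExtendHom.
Local Open Scope ring_scope.
Variables (L F : fieldType) (j : {rmorphism L -> F}) (a : F).
Local Notation ev p := (map_poly j p).[a].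

Let evM p q : ev (p * q) = ev p * ev q.
Proof. by rewrite rmorphM hornerM. Qed.

Let evB p q : ev (p - q) = ev p - ev q.
Proof. by rewrite rmorphB hornerD hornerN. Qed.

Lemma monic_matrix (m : {poly L}) : m \is monic -> (1 < size m)%N ->
  exists n (C : 'M[L]_n.+1), horner_mx C m = 0.
Proof.
move=> m_monic m_gt1.
suff main k (C : 'M[L]_k) : k = (size m).-1 -> char_poly C = m ->
    exists n (C : 'M[L]_n.+1), horner_mx C m = 0.
  exact: (main _ (companionmx m) _ (companionmxK m_monic)).
case: k C => [C|n C _ CE]; first by case: (size m) m_gt1 => [|[]].
exists n, C.
by rewrite -CE Cayley_Hamilton.
Qed.

Lemma minimal_poly_exists (p : {poly L}) : p != 0 -> ev p = 0 ->
  exists m, [/\ m \is monic, ev m = 0 &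
    forall q, q != 0 -> ev q = 0 -> (size m <= size q)%N].
Proof.
move=> p0 pa0.
pose P n := `[< exists q, [/\ q != 0, ev q = 0 & size q = n] >].
have exP : exists n, P n by exists (size p); apply/asboolP; exists p.
have [n /asboolP[q [q0 qa0 sq]] n_min] := ex_minnP exP.
exists ((lead_coef q)^-1 *: q); split=> [||r r0 ra0].
- by rewrite monicE lead_coefZ mulVf // lead_coef_eq0.
- by rewrite map_polyZ hornerZ qa0 mulr0.
rewrite size_scale ?invr_eq0 ?lead_coef_eq0 // sq; apply: n_min.
by apply/asboolP; exists r.
Qed.

(** The gcd of [p] and [m] does not vanish at [a], so the cofactor of the gcd in
    [m] does; by minimality this cofactor is as large as [m]. *)
Lemma coprime_minimal_poly (m p : {poly L}) : ev m = 0 -> m != 0 ->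
  (forall q, q != 0 -> ev q = 0 -> (size m <= size q)%N) ->
  ev p != 0 -> coprimep p m.
Proof.
move=> m0 m_neq0 m_min p0; rewrite /coprimep.
have /dvdpP[h mE] := dvdp_gcdr p m; have /dvdpP[k pE] := dvdp_gcdl p m.
have g0 : ev (gcdp p m) != 0.
  by apply: contraNneq p0 => g0; rewrite pE evM g0 mulr0.
have h0 : ev h = 0.
  by move: m0; rewrite mE evM => /eqP; rewrite mulf_eq0 (negPf g0) orbF => /eqP.
have hn0 : h != 0 by apply: contraNneq m_neq0 => h00; rewrite mE h00 mul0r.
have gn0 : gcdp p m != 0 by apply: contraNneq g0 => ->; rewrite rmorph0 horner0.
have := m_min h hn0 h0; rewrite {1}mE size_mul //.
move: gn0; rewrite -size_poly_gt0; case: (size (gcdp p m)) => // d _.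
by rewrite addnS /= -[X in (_ <= X)%N]addn0 leq_add2l leqn0.
Qed.

(** Composing [v] with the norm from L(a) to L extends [v] up to the factor
    [L(a) : L].  The norm of p(a) is the determinant of p(C) for a matrix C
    annihilated by the minimal polynomial of [a]. *)
Lemma adjoin_algebraic (v : L -> int) (p : {poly L}) (f : L) :
  mul_to_add v -> f != 0 -> v f != 0 -> p != 0 -> ev p = 0 ->
  exists2 v' : adjoin_field j a -> int, mul_to_add v' &
    forall y, adjoin_inj j a y = j f -> y != 0 -> v' y != 0.
Proof.
move=> vM f0 vf p0 pa0; have [m [m_monic ma0 m_min]] := minimal_poly_exists p0 pa0.
have mn0 := monic_neq0 m_monic.
have m_gt1 : (1 < size m)%N.
  rewrite ltnNge; apply/negP => /size1_polyC mE.
  move: ma0 mn0; rewrite mE map_polyC hornerC => /eqP; rewrite fmorph_eq0 => /eqP->.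
  by rewrite eqxx.
have [n [C mC0]] := monic_matrix m_monic m_gt1.
pose N (q : {poly L}) := \det (horner_mx C q).
have NM q r : N (q * r) = N q * N r by rewrite /N rmorphM det_mulmx.
have N0 q : ev q != 0 -> N q != 0.
  move=> /(coprime_minimal_poly ma0 mn0 m_min)/Bezout_eq1_coprimepP[[u w] /= uw].
  apply/eqP => Nq0; have := congr1 N uw.
  rewrite /N rmorphD !rmorphM /= mC0 mulr0 addr0 rmorph1 det_mulmx -/(N q) Nq0.
  by rewrite mulr0 det1 => /esym/eqP; rewrite oner_eq0.
have v1 : v 1 = 0.
  by apply: (addrI (v 1)); rewrite addr0 -vM ?oner_neq0 // mulr1.
have vX x k : x != 0 -> v (x ^+ k) = v x *+ k.
  move=> x0; elim: k => [|k IH]; first by rewrite expr0 v1.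
  by rewrite exprS vM ?expf_neq0 // IH mulrS.
have [|q r qr q0|v' v'M v'E] := @adjoin_hom _ _ j a (fun q => v (N q)).
- by move=> q r q0 r0; rewrite NM vM ?N0.
- congr (v (\det _)); apply/eqP; rewrite -subr_eq0 -rmorphB /=.
  suff /dvdpP[s ->] : m %| q - r by rewrite rmorphM /= mC0 mulr0.
  apply: contraT => ndvd; have mod0 : (q - r) %% m != 0 by [].
  have := m_min _ mod0; rewrite leqNgt ltn_modp mn0 => /(_ _)/negP[] //.
  have := congr1 (fun t => ev t) (divp_eq (q - r) m).
  by rewrite /= evB qr subrr rmorphD hornerD evM ma0 mulr0 add0r => <-.
exists v' => // y yf y0; rewrite (v'E f%:P) //; last by rewrite map_polyC hornerC.
rewrite /N horner_mx_C det_scalar vX // Num.Theory.mulrn_eq0 /=; exact: vf.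
Qed.

(** The leading coefficient is multiplicative on L[X], so L(X)^* retracts onto
    L^*. *)
Lemma adjoin_transcendental (v : L -> int) :
  mul_to_add v -> (forall p, p != 0 -> ev p != 0) ->
  exists2 v' : adjoin_field j a -> int, mul_to_add v' &
    forall y c, adjoin_inj j a y = j c -> y != 0 -> v' y = v c.
Proof.
move=> vM a_tr.
have ev0 p : ev p != 0 -> p != 0.
  by apply: contraNneq => ->; rewrite rmorph0 horner0.
have [|q r qr q0|v' v'M v'E] := @adjoin_hom _ _ j a (fun q => v (lead_coef q)).
- by move=> q r /ev0 q0 /ev0 r0; rewrite lead_coefM vM ?lead_coef_eq0.
- have [/eqP|/a_tr] := eqVneq (q - r) 0; first by rewrite subr_eq0 => /eqP->.
  by rewrite evB qr subrr eqxx.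
exists v' => // y c yc y0.
by rewrite (v'E c%:P) ?lead_coefC // map_polyC hornerC.
Qed.

(** Starting point of the extension process: the degree on K(f)^*. *)
Lemma adjoin_degree : (forall p, p != 0 -> ev p != 0) ->
  exists2 v : adjoin_field j a -> int, mul_to_add v &
    forall y, adjoin_inj j a y = a -> v y != 0.
Proof.
move=> a_tr.
have ev0 p : ev p != 0 -> p != 0.
  by apply: contraNneq => ->; rewrite rmorph0 horner0.
have [|q r qr q0|v v'M v'E] := @adjoin_hom _ _ j a (fun q => (size q).-1%:Z).
- move=> q r /ev0 q0 /ev0 r0; rewrite size_mul // -PoszD; congr Posz.
  move: q0 r0; rewrite -!size_poly_gt0.
  by case: (size q) => [|d] //; case: (size r) => [|d'] //; rewrite addSn addnS.
- have [/eqP|/a_tr] := eqVneq (q - r) 0; first by rewrite subr_eq0 => /eqP->.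
  by rewrite evB qr subrr eqxx.
exists v => // y ya; have a0 : a != 0.
  by have := a_tr 'X; rewrite polyX_eq0 map_polyX hornerX => ->.
rewrite (v'E 'X) ?map_polyX ?hornerX ?size_polyX //.
by apply: contraNneq a0 => y0; rewrite -ya y0 rmorph0.
Qed.

Lemma adjoin_range_base c : exists y, adjoin_inj j a y = j c.
Proof.
have M : j c \in adjoin j a by have := mem_adjoin j a c%:P; rewrite map_polyC hornerC.
by exists (AdjoinField M).
Qed.

Lemma adjoin_range_gen : exists y, adjoin_inj j a y = a.
Proof.
have M : a \in adjoin j a by have := mem_adjoin j a 'X; rewrite map_polyX hornerX.
by exists (AdjoinField M).
Qed.
End ExtendHom.

Section FunctionField.
Local Open Scope ring_scope.
Variables (K : closedFieldType) (F : fieldType) (iota : {rmorphism K -> F}).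

Lemma transcendental_over_closed (a : F) : (forall c, a != iota c) ->
  forall p, p != 0 -> (map_poly iota p).[a] != 0.
Proof.
move=> aNK p p0; have [r ->] := closed_field_poly_normal p.
rewrite map_polyZ hornerZ mulf_neq0 ?fmorph_eq0 ?lead_coef_eq0 //.
rewrite rmorph_prod horner_prod prodf_seq_neq0; apply/allP => z _ /=.
by rewrite map_polyXsubC hornerXsubC subr_eq0 aNK.
Qed.

Lemma adjoin_step (L : fieldType) (j : {rmorphism L -> F}) (v : L -> int)
    (f : L) (a : F) : mul_to_add v -> f != 0 -> v f != 0 ->
  exists (L' : fieldType) (j' : {rmorphism L' -> F}) (v' : L' -> int) (f' : L'),
    [/\ mul_to_add v', v' f' != 0, j' f' = j f,
        forall c, exists y, j' y = j c & exists y, j' y = a].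
Proof.
move=> vM f0 vf; have [f' f'E] := adjoin_range_base j a f.
have f'0 : f' != 0.
  by apply: contraNneq f0 => f'0; rewrite -(fmorph_eq0 j) -f'E f'0 rmorph0.
suff [v' v'M v'f] : exists2 v' : adjoin_field j a -> int, mul_to_add v' &
    v' f' != 0.
  exists (adjoin_field j a), (adjoin_inj j a), v', f'; split=> //.
    exact: adjoin_range_base.
  exact: adjoin_range_gen.
have [[p [p0 pa0]]|alg] := pselect (exists p, p != 0 /\ (map_poly j p).[a] = 0).
  by have [v' v'M v'f] := adjoin_algebraic vM f0 vf p0 pa0; exists v' => //; exact: v'f.
have [p p0|v' v'M v'f] := @adjoin_transcendental _ _ j a v vM.
  by apply/eqP => pa0; apply: alg; exists p.
by exists v' => //; rewrite (v'f _ f).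
Qed.

(** The hypothesis on [xs] says that [F] is generated as a field by [K] and
    [xs]; the homomorphism is extended from K(f) to [F] by adjoining the
    elements of [xs] one after the other. *)
Theorem function_field_hom (xs : seq F) (f : F) :
  (forall S : F -> Prop, divring_closed [pred x | `[< S x >]] ->
     (forall c, S (iota c)) -> (forall x, x \in xs -> S x) -> forall x, S x) ->
  (forall c, f != iota c) ->
  exists2 v : F -> int, mul_to_add v & v f != 0.
Proof.
move=> gen fNK.
have [v0 v0M v0f] := adjoin_degree (transcendental_over_closed fNK).
have [f0 f0E] := adjoin_range_gen iota f.
have [L [j [v [g [vM vg gE base xsE]]]]] : exists (L : fieldType)
    (j : {rmorphism L -> F}) (v : L -> int) (g : L), [/\ mul_to_add v, v g != 0,
    j g = f, forall c, exists y, j y = iota c & forall x, x \in xs -> exists y, j y = x].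
  elim: xs {gen} => [|a xs [L [j [v [g [vM vg gE base xsE]]]]]].
    exists (adjoin_field iota f), (adjoin_inj iota f), v0, f0.
    by split=> //; [exact: v0f | exact: adjoin_range_base].
  have g0 : g != 0.
    by apply: contraNneq (fNK 0) => g0; rewrite -gE g0 !rmorph0.
  have [L' [j' [v' [g' [vM' vg' gE' base' aE]]]]] := adjoin_step j a vM g0 vg.
  exists L', j', v', g'; split=> //; first by rewrite gE'.
    by move=> c; have [y <-] := base c; exact: base'.
  move=> x; rewrite inE => /orP[/eqP->|/xsE[y <-]]; first exact: aE.
  exact: base'.
have j_surj y : exists x, j x = y.
  apply: (gen (fun y => exists x, j x = y)) => //; split.
  - by apply/asboolP; exists 1; rewrite rmorph1.
  - move=> _ _ /asboolP[x <-] /asboolP[z <-]; apply/asboolP.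
    by exists (x - z); rewrite rmorphB.
  - move=> _ _ /asboolP[x <-] /asboolP[z <-]; apply/asboolP.
    by exists (x / z); rewrite fmorph_div.
pose pre y := projT1 (cid (j_surj y)).
have preE y : j (pre y) = y by exact: projT2 (cid (j_surj y)).
have preK x : pre (j x) = x by apply: (fmorph_inj j); rewrite preE.
have pre0 y : y != 0 -> pre y != 0.
  by apply: contraNneq => y0; rewrite -(preE y) y0 rmorph0.
exists (v \o pre) => [x y x0 y0|] /=; last by rewrite -gE preK.
by rewrite -vM ?pre0 // -{1}(preE x) -{1}(preE y) -rmorphM preK.
Qed.
End FunctionField.

(** * Regular functions on a variety *)

Section FunSpaceTheory.
Local Open Scope ring_scope.
Local Open Scope classical_set_scope.
Variables (K : closedFieldType) (X : funSpace K).
Implicit Types (U O N : set X) (f g h : X -> K).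

Lemma open_local O :
  (forall x, O x -> exists N, [/\ open N, N x & N `<=` O]) -> open O.
Proof.
move=> loc; rewrite openE => x /loc[N [oN Nx NO]].
by apply: filterS NO _; exact: open_nbhs_nbhs.
Qed.

Lemma reg_eq O f g : (forall x, O x -> f x = g x) -> reg O f -> reg O g.
Proof. by move=> fg; apply: reg_ext => x; rewrite inE; exact: fg. Qed.

Lemma reg_sub O f g : open O -> reg O f -> reg O g -> reg O (fun x => f x - g x).
Proof.
move=> oO fr gr; apply: (@reg_eq _ (fun x => f x + -1 * g x)) => [x _|].
  by rewrite mulN1r.
by apply: reg_add => //; apply: reg_mul => //; exact: reg_cst.
Qed.

Lemma reg_exp O f k : open O -> reg O f -> reg O (fun x => f x ^+ k).
Proof.
move=> oO fr; elim: k => [|k IH]; first exact: reg_cst.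
apply: (reg_eq (f := fun x => f x * f x ^+ k)) => [x _|].
  by rewrite exprS.
exact: reg_mul.
Qed.

Lemma reg_local O f :
  (forall x, O x -> exists N g,
     [/\ open N, N x, N `<=` O, reg N g & forall y, N y -> f y = g y]) ->
  reg O f.
Proof.
move=> loc; pose C := [set N | [/\ open N, N `<=` O & reg N f]].
have -> : O = \bigcup_(N in C) N.
  rewrite predeqE => x; split=> [/loc[N [g [oN Nx NO gr fg]]]|[N [_ NO _] /NO//]].
  by exists N => //; split=> //; apply: reg_eq gr => y /fg.
by apply: reg_glue => N [].
Qed.

(** What [affine_open] asks of a chart, so that several facts can be stated about
    one and the same chart. *)
Definition is_chart U n (phi : X -> 'I_n -> K) :=
  [/\ {in U &, injective phi}, algebraic_set (phi @` U),
      forall U', U' `<=` U ->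
        open U' <-> exists2 A, algebraic_set A & U' = U `\` phi @^-1` A
    & forall U' f, open U' -> U' `<=` U ->
        reg U' f <-> forall x, U' x ->
          exists N (p q : {mpoly K[n]}), [/\ open_nbhs x N, N `<=` U'
            & forall y, N y ->
                q.@[phi y] != 0 /\ f y = p.@[phi y] / q.@[phi y]] ].

Section Chart.
Variables (U : set X) (n : nat) (phi : X -> 'I_n -> K).
Hypotheses (oU : open U) (chartU : is_chart U phi).

Lemma chart_nbhs O x : open O -> U x -> O x ->
  exists2 s : {mpoly K[n]}, s.@[phi x] != 0 &
    forall y, U y -> s.@[phi y] != 0 -> O y.
Proof.
move=> oO Ux Ox; have [_ _ opE _] := chartU.
have /(opE (O `&` U))[] : O `&` U `<=` U by move=> y [].
case=> [|A [S ->] OE _]; first exact: openI.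
have : (O `&` U) x by [].
rewrite {1}OE => -[_ nA]; apply: contrapT => nex; apply: nA => p Sp.
apply/eqP; apply: contraT => p0; case: nex; exists p => // y Uy py.
suff: (O `&` U) y by case.
by rewrite OE; split=> // /(_ p Sp)/eqP; rewrite (negPf py).
Qed.

Lemma chart_open (s : {mpoly K[n]}) : open (U `&` [set y | s.@[phi y] != 0]).
Proof.
have [_ _ opE _] := chartU; apply/opE; first by move=> y [].
exists [set v | forall p, [set s] p -> p.@[v] = 0]; first by exists [set s].
rewrite predeqE => y; split=> -[Uy sy]; split=> //.
  by move=> /(_ s erefl)/eqP; rewrite (negPf sy).
by apply/negP => /eqP s0; apply: sy => p ->.
Qed.

(** A regular function is near each point a quotient of polynomials whose
    denominator also cuts out the neighbourhood, so that one polynomial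
    [s] does both jobs. *)
Lemma chart_reg O h x : open O -> reg O h -> U x -> O x ->
  exists p s : {mpoly K[n]}, s.@[phi x] != 0 /\
    forall y, U y -> s.@[phi y] != 0 ->
      O y /\ h y = p.@[phi y] / s.@[phi y].
Proof.
move=> oO hr Ux Ox; have [_ _ _ regE] := chartU.
have oOU : open (O `&` U) by exact: openI.
have := regE (O `&` U) h oOU (fun y yOU => yOU.2).
case=> + _ => /(_ (reg_restr oO oOU (fun y yOU => yOU.1) hr) x (conj Ox Ux)).
move=> [N [p [q [[oN Nx] NO Nq]]]].
have [s sx sN] := chart_nbhs oN Ux Nx; have [qx _] := Nq x Nx.
exists (p * s), (q * s); rewrite mevalM mulf_neq0 //; split=> // y Uy.
rewrite !mevalM mulf_eq0 negb_or => /andP[qy sy].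
have Ny := sN y Uy sy; have [_ ->] := Nq y Ny; have [Oy _] := NO y Ny; split=> //.
by rewrite -mulf_div divff ?mulr1.
Qed.

Lemma chart_quot_reg (p s : {mpoly K[n]}) :
  reg (U `&` [set y | s.@[phi y] != 0]) (fun y => p.@[phi y] / s.@[phi y]).
Proof.
have [_ _ _ regE] := chartU; apply/regE; first exact: chart_open.
  by move=> y [].
move=> x xs; exists (U `&` [set y | s.@[phi y] != 0]), p, s.
by split=> [|//|y [_ ys]//]; split=> //; exact: chart_open.
Qed.

Lemma chart_poly_reg (p : {mpoly K[n]}) : reg U (fun y => p.@[phi y]).
Proof.
have := chart_quot_reg p 1; rewrite (_ : U `&` _ = U).
  by apply: reg_eq => y _; rewrite meval1 divr1.
by rewrite predeqE => y; split=> [[]//|Uy]; split=> //=; rewrite meval1 oner_neq0.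
Qed.

End Chart.

Definition locally_affine := forall x : X, exists2 U, U x & affine_open U.

Hypothesis X_affine : locally_affine.

Lemma nonzero_open O h : open O -> reg O h -> open (O `&` [set y | h y != 0]).
Proof.
move=> oO hr; apply: open_local => x [Ox hx].
have [U Ux [oU [n [phi chartU]]]] := X_affine x.
have [p [s [sx sP]]] := chart_reg oU chartU oO hr Ux Ox.
exists (U `&` [set y | (p * s).@[phi y] != 0]); split.
- exact: chart_open.
- split=> //=; rewrite mevalM mulf_neq0 //.
  have [_ hE] := sP x Ux sx; apply: contraNneq hx => p0.
  by rewrite hE p0 mul0r.
- move=> y [Uy] /=; rewrite mevalM mulf_eq0 negb_or => /andP[py sy].
  have [Oy hE] := sP y Uy sy; split=> //=.
  by rewrite hE mulf_neq0 // invr_eq0.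
Qed.

Lemma reg_inv O h : open O -> reg O h ->
  reg (O `&` [set y | h y != 0]) (fun y => (h y)^-1).
Proof.
move=> oO hr; apply: reg_local => x [Ox hx].
have [U Ux [oU [n [phi chartU]]]] := X_affine x.
have [p [s [sx sP]]] := chart_reg oU chartU oO hr Ux Ox.
have ps y : U y -> s.@[phi y] != 0 -> h y != 0 -> p.@[phi y] != 0.
  by move=> Uy /(sP y Uy)[_ ->]; apply: contraNneq => ->; rewrite mul0r.
exists (U `&` [set y | (p * s).@[phi y] != 0]),
  (fun y => (s * s).@[phi y] / (p * s).@[phi y]); split.
- exact: chart_open.
- by split=> //=; rewrite mevalM mulf_neq0 // ps.
- move=> y [Uy] /=; rewrite mevalM mulf_eq0 negb_or => /andP[py sy].
  have [Oy hE] := sP y Uy sy; split=> //=.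
  by rewrite hE mulf_neq0 // invr_eq0.
- exact: chart_quot_reg.
- move=> y [Uy] /=; rewrite !mevalM mulf_eq0 negb_or => /andP[py sy].
  have [_ ->] := sP y Uy sy.
  by rewrite -mulf_div divff // mulr1 invf_div.
Qed.

Hypothesis X_irr : irreducible [set: X].

Lemma irreducible_meet O N : open O -> open N -> O !=set0 -> N !=set0 ->
  (O `&` N) !=set0.
Proof.
move=> oO oN [x Ox] [y Ny]; have [_ irr] := X_irr.
apply: contrapT => ON0; have := irr (~` O) (~` N).
case=> [| | z _|/(_ x I)|/(_ y I)] //; try exact: open_closedC.
by apply: contrapT => /not_orP[/contrapT Oz /contrapT Nz]; apply: ON0; exists z.
Qed.

(** The identity principle: two regular functions differ on an open set, which
    is empty if it misses a nonempty open set. *)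
Lemma reg_eq_dense O N f g : open O -> open N -> reg O f -> reg O g ->
  (O `&` N) !=set0 -> (forall x, O x -> N x -> f x = g x) ->
  forall x, O x -> f x = g x.
Proof.
move=> oO oN fr gr ON fg x Ox; apply/eqP; apply: contraT => fgx.
have oD := nonzero_open oO (reg_sub oO fr gr).
have [||z [[Oz /= + ] [_ Nz]]] := irreducible_meet oD (openI oO oN).
- by exists x; split=> //=; rewrite subr_eq0.
- by [].
- by rewrite fg // subrr eqxx.
Qed.

End FunSpaceTheory.

(** * The covering extracting an l-th root of a function *)

Section RootCover.
Local Open Scope ring_scope.
Local Open Scope classical_set_scope.
Variables (K : closedFieldType) (V : funSpace K) (f : V -> K) (l : nat).

Record root_cover := RootCover {
  cover_pair : V * K;
  _ : cover_pair.2 ^+ l == f cover_pair.1 }.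
HB.instance Definition _ := [isSub for cover_pair].
HB.instance Definition _ := [Choice of root_cover by <:].

Definition cover_proj (w : root_cover) : V := (val w).1.
Definition cover_root (w : root_cover) : K := (val w).2.
Local Notation pr := cover_proj.
Local Notation rt := cover_root.

Lemma cover_rootX w : rt w ^+ l = f (pr w).
Proof. by apply/eqP; exact: valP w. Qed.

Lemma cover_eq w w' : pr w = pr w' -> rt w = rt w' -> w = w'.
Proof.
move=> ew er; apply: val_inj.
by rewrite [LHS]surjective_pairing [RHS]surjective_pairing; congr (_, _).
Qed.

(** The algebra generated over O(U) by the root [cover_root].  As an inductive
    predicate it is obviously stable under products; that degrees less than [l]
    suffice is [poly_fun_normal_form]. *)
Inductive poly_fun (U : set V) : (root_cover -> K) -> Prop :=
| poly_fun_base a : reg U a -> poly_fun U (a \o pr)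
| poly_fun_root : poly_fun U rt
| poly_fun_add P Q : poly_fun U P -> poly_fun U Q -> poly_fun U (fun w => P w + Q w)
| poly_fun_mul P Q : poly_fun U P -> poly_fun U Q -> poly_fun U (fun w => P w * Q w).

Lemma poly_fun_restr U U' P : open U -> open U' -> U' `<=` U ->
  poly_fun U P -> poly_fun U' P.
Proof.
move=> oU oU' sub; elim=> [a ar||P1 Q _ IHP _ IHQ|P1 Q _ IHP _ IHQ].
- by apply: poly_fun_base; exact: reg_restr ar.
- exact: poly_fun_root.
- exact: poly_fun_add.
- exact: poly_fun_mul.
Qed.

Lemma poly_fun_cst U c : open U -> poly_fun U (fun=> c).
Proof. by move=> oU; apply: (@poly_fun_base U (fun=> c)); exact: reg_cst. Qed.

Lemma poly_fun_sum U (I : Type) (r : seq I) (F : I -> root_cover -> K) :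
  open U -> (forall i, poly_fun U (F i)) ->
  poly_fun U (fun w => \sum_(i <- r) F i w).
Proof.
move=> oU FP; elim: r => [|i r IH].
  by under eq_fun do rewrite big_nil; exact: poly_fun_cst.
by under eq_fun do rewrite big_cons; exact: poly_fun_add.
Qed.

Lemma poly_fun_prod U (I : Type) (r : seq I) (P : pred I) (F : I -> root_cover -> K) :
  open U -> (forall i, poly_fun U (F i)) ->
  poly_fun U (fun w => \prod_(i <- r | P i) F i w).
Proof.
move=> oU FP; elim: r => [|i r IH].
  by under eq_fun do rewrite big_nil; exact: poly_fun_cst.
under eq_fun do rewrite big_cons.
by case: (P i) => //; exact: poly_fun_mul.
Qed.

(** The non-vanishing loci of the functions in [poly_fun U], for all open U, are
    a basis of the topology; preimages of open sets of the base alone would not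
    separate the points of a fibre. *)
Definition cover_open (O : set root_cover) := forall w, O w -> exists U Q,
  [/\ open U, U (pr w), poly_fun U Q, Q w != 0 &
    forall w', U (pr w') -> Q w' != 0 -> O w'].

Fact cover_openT : cover_open setT.
Proof.
move=> w _; exists setT, (fun=> 1); split=> //; first exact: openT.
- by apply: poly_fun_cst; exact: openT.
- exact: oner_neq0.
Qed.

Fact cover_openI : setI_closed cover_open.
Proof.
move=> A B oA oB w [/oA[U [P [oU Uw PP Pw PA]]] /oB[U' [Q [oU' Uw' PQ Qw QB]]]].
have oUU : open (U `&` U') by exact: openI.
exists (U `&` U'), (fun w => P w * Q w); split=> //; last first.
- move=> w' [? ?]; rewrite mulf_eq0 negb_or => /andP[? ?].
  by split; [exact: PA | exact: QB].
- by rewrite mulf_neq0.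
by apply: poly_fun_mul; [apply: poly_fun_restr PP | apply: poly_fun_restr PQ] => // v [].
Qed.

Fact cover_open_bigU (I : Type) (F : I -> set root_cover) :
  (forall i, cover_open (F i)) -> cover_open (\bigcup_i F i).
Proof.
move=> oF w [i _ /oF[U [Q [oU Uw PQ Qw QF]]]]; exists U, Q; split=> // w' ? ?.
by exists i => //; exact: QF.
Qed.

HB.instance Definition _ := isOpenTopological.Build root_cover
  cover_openT cover_openI cover_open_bigU.

Lemma open_coverE (O : set root_cover) : open O = cover_open O.
Proof. by []. Qed.

Lemma basic_open U Q : open U -> poly_fun U Q ->
  open [set w | U (pr w) /\ Q w != 0].
Proof. by move=> oU PQ; rewrite open_coverE => w [Uw Qw]; exists U, Q. Qed.

Definition cover_reg (O : set root_cover) (h : root_cover -> K) :=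
  forall w, O w -> exists U P Q,
    [/\ open U, U (pr w), poly_fun U P, poly_fun U Q & Q w != 0 /\
      forall w', O w' -> U (pr w') -> Q w' != 0 -> h w' = P w' / Q w'].

Fact cover_reg_ext O g h : {in O, g =1 h} -> cover_reg O g -> cover_reg O h.
Proof.
move=> gh gr w /[dup] Ow /gr[U [P [Q [oU Uw PP PQ [Qw gE]]]]].
exists U, P, Q; split=> //; split=> // w' Ow' Uw' Qw'.
by rewrite -gh ?inE // gE.
Qed.

Fact cover_reg_restr O O' h : open O -> open O' -> O' `<=` O ->
  cover_reg O h -> cover_reg O' h.
Proof.
move=> _ _ sub hr w /sub/hr[U [P [Q [oU Uw PP PQ [Qw hE]]]]].
exists U, P, Q; split=> //; split=> // w' /sub; exact: hE.
Qed.

Fact cover_reg_glue (C : set (set root_cover)) h :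
  (forall O, C O -> open O /\ cover_reg O h) ->
  cover_reg (\bigcup_(O in C) O) h.
Proof.
move=> Cr w [O CO Ow]; have [oO hr] := Cr O CO.
have [U [P [Q [oU Uw PP PQ [Qw hE]]]]] := hr w Ow.
have [U' [R [oU' Uw' PR Rw RO]]] := oO w Ow.
have oUU : open (U `&` U') by exact: openI.
have P' : poly_fun (U `&` U') P by apply: poly_fun_restr PP => // v [].
have Q' : poly_fun (U `&` U') Q by apply: poly_fun_restr PQ => // v [].
have R' : poly_fun (U `&` U') R by apply: poly_fun_restr PR => // v [].
exists (U `&` U'), (fun w => P w * R w), (fun w => Q w * R w).
split=> //; [exact: poly_fun_mul|exact: poly_fun_mul|].
split=> [|w' _ [Uw1 Uw2]]; first by rewrite mulf_neq0.
rewrite mulf_eq0 negb_or => /andP[Qw' Rw'].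
by rewrite -mulf_div divff // mulr1 hE //; exact: RO.
Qed.

Fact cover_reg_cst O c : open O -> cover_reg O (fun=> c).
Proof.
move=> _ w Ow; exists setT, (fun=> c), (fun=> 1); have oT := @openT V.
split=> //; [exact: poly_fun_cst|exact: poly_fun_cst|].
by split=> [|w' _ _ _]; [exact: oner_neq0 | rewrite divr1].
Qed.

(** Sum and product at once: [num] computes the numerator of the result over
    the product of the denominators. *)
Fact cover_reg_op (op : K -> K -> K) (num : K -> K -> K -> K -> K) O g h :
  (forall U P Q R S, poly_fun U P -> poly_fun U Q -> poly_fun U R -> poly_fun U S ->
     poly_fun U (fun w => num (P w) (Q w) (R w) (S w))) ->
  (forall p q r s, q != 0 -> s != 0 ->
     op (p / q) (r / s) = num p q r s / (q * s)) ->
  cover_reg O g -> cover_reg O h -> cover_reg O (fun w => op (g w) (h w)).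
Proof.
move=> numP opE gr hr w Ow.
have [U [P [Q [oU Uw PP PQ [Qw gE]]]]] := gr w Ow.
have [U' [R [S [oU' Uw' PR PS [Sw hE]]]]] := hr w Ow.
have oUU : open (U `&` U') by exact: openI.
have P' : poly_fun (U `&` U') P by apply: poly_fun_restr PP => // v [].
have Q' : poly_fun (U `&` U') Q by apply: poly_fun_restr PQ => // v [].
have R' : poly_fun (U `&` U') R by apply: poly_fun_restr PR => // v [].
have S' : poly_fun (U `&` U') S by apply: poly_fun_restr PS => // v [].
exists (U `&` U'), (fun w => num (P w) (Q w) (R w) (S w)), (fun w => Q w * S w).
split=> //; [exact: numP|exact: poly_fun_mul|].
split=> [|w' Ow' [Uw1 Uw2]]; first by rewrite mulf_neq0.
rewrite mulf_eq0 negb_or => /andP[Qw' Sw'].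
by rewrite gE // hE // opE.
Qed.

Fact cover_reg_add O g h : open O -> cover_reg O g -> cover_reg O h ->
  cover_reg O (fun w => g w + h w).
Proof.
move=> _; apply: (cover_reg_op (num := fun p q r s => p * s + r * q)) => //.
  by move=> *; apply: poly_fun_add; exact: poly_fun_mul.
by move=> p q r s q0 s0; rewrite addf_div.
Qed.

Fact cover_reg_mul O g h : open O -> cover_reg O g -> cover_reg O h ->
  cover_reg O (fun w => g w * h w).
Proof.
move=> _; apply: (cover_reg_op (num := fun p q r s => p * r)) => //.
  by move=> *; exact: poly_fun_mul.
by move=> p q r s q0 s0; rewrite mulf_div.
Qed.

Definition cover_space : funSpace K := FunSpace cover_reg_ext cover_reg_restr
  cover_reg_glue cover_reg_cst cover_reg_add cover_reg_mul.

Fact cover_proj_cont : continuous (cover_proj : cover_space -> V).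
Proof.
apply/continuousP => U oU; rewrite open_coverE => w Uw.
exists U, (fun=> 1); split=> //; first exact: poly_fun_cst.
exact: oner_neq0.
Qed.

Fact cover_proj_reg U g : open U -> reg U g ->
  reg ((cover_proj : cover_space -> V) @^-1` U) (g \o cover_proj).
Proof.
move=> oU gr w Uw; exists U, (g \o pr), (fun=> 1); split=> //.
- exact: poly_fun_base.
- exact: poly_fun_cst.
- by split=> [|w' _ _ _]; [exact: oner_neq0 | rewrite divr1].
Qed.

Definition cover_map : morphism cover_space V :=
  Morphism cover_proj_cont cover_proj_reg.

Lemma poly_fun_quot_reg (O : set cover_space) U P Q :
  open U -> poly_fun U P -> poly_fun U Q ->
  O `<=` [set w | U (pr w) /\ Q w != 0] ->
  reg O (fun w => P w / Q w).
Proof. by move=> oU PP PQ OU w /OU[Uw Qw]; exists U, P, Q. Qed.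

Lemma poly_fun_reg U P : open U -> poly_fun U P ->
  reg (cover_map @^-1` U) P.
Proof.
move=> oU PP w Uw; exists U, P, (fun=> 1); split=> //; first exact: poly_fun_cst.
by split=> [|w' _ _ _]; [exact: oner_neq0 | rewrite divr1].
Qed.

End RootCover.

Section CoverAffine.
Local Open Scope ring_scope.
Local Open Scope classical_set_scope.
Variables (K : closedFieldType) (V : funSpace K) (f : V -> K) (l : nat).
Hypothesis f_reg : reg setT f.
Local Notation W := (cover_space f l).
Local Notation pr := (@cover_proj K V f l).
Local Notation rt := (@cover_root K V f l).

Lemma poly_fun_exp U P k : open U -> @poly_fun _ _ f l U P ->
  poly_fun U (fun w => P w ^+ k).
Proof.
move=> oU PP; elim: k => [|k IH]; first exact: poly_fun_cst.
by under eq_fun do rewrite exprS; exact: poly_fun_mul.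
Qed.

Variables (U : set V) (n : nat) (phi : V -> 'I_n -> K).
Hypotheses (oU : open U) (chartU : is_chart U phi).

(* The chart of the preimage of U adds the root as the coordinate of index 0. *)
Let psi (w : W) (i : 'I_n.+1) : K :=
  if unlift ord0 i is Some j then phi (pr w) j else rt w.

(* A polynomial in the coordinates of U, seen as one in those of psi. *)
Let lp (p : {mpoly K[n]}) : {mpoly K[n.+1]} :=
  (p \mPo [tuple 'X_(lift ord0 i) | i < n]).

Let lpE p v : (lp p).@[v] = p.@[fun i => v (lift ord0 i)].
Proof.
rewrite /lp comp_mpoly_meval; apply: meval_eq => i.
by rewrite tnth_mktuple mevalXU.
Qed.

Let psi0 w : psi w ord0 = rt w.
Proof. by rewrite /psi unlift_none. Qed.

Let psi_lift w : (fun i => psi w (lift ord0 i)) = phi (pr w).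
Proof. by apply/funext => i; rewrite /psi liftK. Qed.

Let lp_psi p w : (lp p).@[psi w] = p.@[phi (pr w)].
Proof. by rewrite lpE psi_lift. Qed.

Let psi_poly_fun (p : {mpoly K[n.+1]}) : poly_fun U (fun w => p.@[psi w]).
Proof.
under eq_fun do rewrite mevalE.
apply: poly_fun_sum => // m; apply: poly_fun_mul; first exact: poly_fun_cst.
apply: poly_fun_prod => // i; apply: poly_fun_exp => //.
rewrite /psi; case: unliftP => [j _|_]; last exact: poly_fun_root.
apply: (@poly_fun_base _ _ f l U (fun v => phi v j)).
apply: (@reg_eq _ V U (fun v : V => ('X_j : {mpoly K[n]}).@[phi v])) => [v _|].
  by rewrite mevalXU.
exact: (chart_poly_reg chartU).
Qed.

Let poly_fun_local U' P (w : W) : open U' -> poly_fun U' P -> U (pr w) -> U' (pr w) ->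
  exists p s : {mpoly K[n.+1]}, s.@[psi w] != 0 /\
    forall w', U (pr w') -> s.@[psi w'] != 0 ->
      U' (pr w') /\ P w' = p.@[psi w'] / s.@[psi w'].
Proof.
move=> oU' PP Uw U'w; elim: PP => [a ar||P1 P2 _ IH1 _ IH2|P1 P2 _ IH1 _ IH2].
- have [p [s [sx sP]]] := chart_reg oU chartU oU' ar Uw U'w.
  exists (lp p), (lp s); rewrite lp_psi; split=> // w' Uw'.
  by rewrite !lp_psi; exact: sP.
- have [s sx sP] := chart_nbhs oU chartU oU' Uw U'w.
  exists (lp s * 'X_ord0), (lp s); rewrite lp_psi; split=> // w' Uw'.
  rewrite !mevalM mevalXU psi0 lp_psi => sw'; split; first exact: sP.
  by rewrite mulrC mulKf.
- have [p1 [s1 [s1w E1]]] := IH1; have [p2 [s2 [s2w E2]]] := IH2.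
  exists (p1 * s2 + p2 * s1), (s1 * s2); rewrite mevalM mulf_neq0 //.
  split=> // w' Uw'; rewrite mevalD !mevalM mulf_eq0 negb_or => /andP[h1 h2].
  have [U'w' ->] := E1 w' Uw' h1; have [_ ->] := E2 w' Uw' h2; split=> //.
  by rewrite addf_div.
- have [p1 [s1 [s1w E1]]] := IH1; have [p2 [s2 [s2w E2]]] := IH2.
  exists (p1 * p2), (s1 * s2); rewrite mevalM mulf_neq0 //.
  split=> // w' Uw'; rewrite !mevalM mulf_eq0 negb_or => /andP[h1 h2].
  have [U'w' ->] := E1 w' Uw' h1; have [_ ->] := E2 w' Uw' h2; split=> //.
  by rewrite mulf_div.
Qed.

Let PU : set W := cover_map f l @^-1` U.

Let psi_inj : {in PU &, injective psi}.
Proof.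
move=> w w'; rewrite !inE => Uw Uw' E; apply: cover_eq; last by rewrite -!psi0 E.
have [phi_inj _ _ _] := chartU; apply: phi_inj; rewrite ?inE //.
by rewrite -!psi_lift E.
Qed.

Let psi_alg : algebraic_set (psi @` PU).
Proof.
have [_ [S SE] _ _] := chartU.
pose S' : set {mpoly K[n.+1]} := [set p | forall w, U (pr w) -> p.@[psi w] = 0].
exists S'; rewrite predeqE => v; split=> [[w Uw <-] p|v0]; first exact.
have : [set v | forall p, S p -> p.@[v] = 0] (fun i => v (lift ord0 i)).
  move=> p Sp; rewrite -lpE; apply: v0 => w Uw; rewrite lp_psi.
  have : [set v | forall p, S p -> p.@[v] = 0] (phi (pr w)).
    by rewrite -SE; exists (pr w).
  exact.
rewrite -SE => -[x Ux xE].
have [p [s [sx sE]]] := chart_reg oU chartU openT f_reg Ux I.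
(* On U the function f is only locally a quotient p / s of polynomials; the
   extra factor s makes s (s t^l - p) vanish on the whole covering. *)
have xl : v ord0 ^+ l = f x.
  have : (lp s * (lp s * 'X_ord0 ^+ l - lp p)).@[v] = 0.
    apply: v0 => w Uw; rewrite mevalM mevalB mevalM rmorphXn /= mevalXU psi0 !lp_psi.
    have [->|sw] := eqVneq s.@[phi (pr w)] 0; first by rewrite mul0r.
    by have [_ fE] := sE _ Uw sw; rewrite cover_rootX fE mulrCA divff // mulr1 subrr mulr0.
  rewrite mevalM mevalB mevalM rmorphXn /= mevalXU !lpE -xE => /eqP.
  rewrite mulf_eq0 (negPf sx) /= subr_eq0 => /eqP spE.
  by have [_ ->] := sE x Ux sx; rewrite -spE mulrC mulKf.
move/eqP: xl => xl; exists (@RootCover K V f l (x, v ord0) xl) => //.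
apply/funext => i; rewrite /psi; case: unliftP => [j ->|-> //].
by rewrite [phi _]xE.
Qed.

Let psi_open (O : set W) : O `<=` PU ->
  open O <-> exists2 A, algebraic_set A & O = PU `\` psi @^-1` A.
Proof.
move=> OU; split=> [|[A [S ->] ->]]; last first.
  rewrite open_coverE => w [Uw nA].
  have [s Ss sw] : exists2 s, S s & s.@[psi w] != 0.
    apply: contrapT => nex; apply: nA => p Sp; apply/eqP; apply: contraT => p0.
    by case: nex; exists p.
  exists U, (fun w => s.@[psi w]); split=> // w' Uw' sw'; split=> // /(_ s Ss)/eqP.
  by rewrite (negPf sw').
rewrite open_coverE => oO.
pose S : set {mpoly K[n.+1]} := [set s | forall w, U (pr w) -> s.@[psi w] != 0 -> O w].
exists [set v | forall p, S p -> p.@[v] = 0]; first by exists S.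
rewrite predeqE => w; split=> [Ow|[Uw nA]]; last first.
  apply: contrapT => nOw; apply: nA => p Sp; apply/eqP; apply: contraT => p0.
  by case: nOw; exact: (Sp w Uw p0).
have Uw := OU w Ow; split=> // w0.
have [U' [Q [oU' U'w PQ Qw QO]]] := oO w Ow.
have [p [s [sw sE]]] := poly_fun_local oU' PQ Uw U'w.
have Sps : S (p * s).
  move=> w' Uw'; rewrite mevalM mulf_eq0 negb_or => /andP[pw' sw'].
  have [U'w' QE] := sE w' Uw' sw'; apply: QO => //.
  by rewrite QE mulf_neq0 // invr_eq0.
have := w0 _ Sps; rewrite mevalM => /eqP; rewrite mulf_eq0 (negPf sw) orbF => /eqP p0.
by have [_ QE] := sE w Uw sw; move: Qw; rewrite QE p0 mul0r eqxx.
Qed.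

Let psi_reg (O : set W) h : open O -> O `<=` PU ->
  reg O h <-> forall w, O w -> exists N (p q : {mpoly K[n.+1]}),
    [/\ open_nbhs w N, N `<=` O
      & forall w', N w' -> q.@[psi w'] != 0 /\ h w' = p.@[psi w'] / q.@[psi w']].
Proof.
move=> oO OU; split=> [hr w Ow|hq w Ow]; last first.
  have [N [p [q [[oN Nw] NO hE]]]] := hq w Ow.
  have [U' [R [oU' U'w PR Rw RN]]] := (oN : cover_open N) w Nw.
  have oUU : open (U `&` U') by exact: openI.
  have R' : poly_fun (U `&` U') R by apply: poly_fun_restr PR => // v [].
  have pP p' : poly_fun (U `&` U') (fun w => p'.@[psi w]).
    by apply: poly_fun_restr (psi_poly_fun p') => // v [].
  exists (U `&` U'), (fun w => p.@[psi w] * R w), (fun w => q.@[psi w] * R w).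
  have [qw _] := hE w Nw.
  split=> //; [by split=> //; exact: OU|exact: poly_fun_mul|exact: poly_fun_mul|].
  split=> [|w' _ [_ U'w']]; first by rewrite mulf_neq0.
  rewrite mulf_eq0 negb_or => /andP[_ Rw'].
  have [qw' ->] := hE w' (RN w' U'w' Rw').
  by rewrite -mulf_div divff // mulr1.
have [U' [P [Q [oU' U'w PP PQ [Qw hE]]]]] := hr w Ow.
have Uw := OU w Ow.
have [p [s [sw sE]]] := poly_fun_local oU' PP Uw U'w.
have [q [r [rw rE]]] := poly_fun_local oU' PQ Uw U'w.
exists (O `&` [set w' | U (pr w') /\ (s * (r * q)).@[psi w'] != 0]), (p * r), (s * q).
have qw : q.@[psi w] != 0.
  have [_ QE] := rE w Uw rw.
  by apply: contraNneq Qw => q0; rewrite QE q0 mul0r.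
split=> [|w' []//|w' [Ow' [Uw' /=]]].
  split; last by split=> //=; split=> //; rewrite !mevalM !mulf_neq0.
  by apply: openI => //; apply: (basic_open (Q := fun w' => (s * (r * q)).@[psi w'])).
rewrite !mevalM !mulf_eq0 !negb_or => /and3P[sw' rw' qw']; split; first by rewrite sw'.
have [U'w' PE] := sE w' Uw' sw'; have [_ QE] := rE w' Uw' rw'.
have Qw' : Q w' != 0 by rewrite QE mulf_neq0 // invr_eq0.
by rewrite hE // PE QE invf_div mulf_div.
Qed.

(** The preimage of an affine open set U is closed in U times the affine line, of
    equation t^l = f, and its functions are locally quotients of polynomials
    since those of U are. *)
Lemma cover_affine : affine_open (cover_map f l @^-1` U).
Proof.
split; first exact: (proj1 (continuousP _) (@cover_proj_cont _ _ f l)).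
by exists n.+1, psi; split; [exact: psi_inj|exact: psi_alg|exact: psi_open|exact: psi_reg].
Qed.

End CoverAffine.

(** * The covering is a variety *)

Section CoverVariety.
Local Open Scope ring_scope.
Local Open Scope classical_set_scope.
Context {K : closedFieldType}.

Fact comp_morphism_cont (X Y Z : funSpace K) (a : morphism X Y) (b : morphism Y Z) :
  continuous (b \o a).
Proof.
move=> x; apply: continuous_comp; first exact: (@mfun_cont _ _ _ a).
exact: (@mfun_cont _ _ _ b).
Qed.

Fact comp_morphism_reg (X Y Z : funSpace K) (a : morphism X Y) (b : morphism Y Z)
    U g : open U -> reg U g -> reg ((b \o a) @^-1` U) (g \o (b \o a)).
Proof.
move=> oU gr; apply: (@mfun_reg _ _ _ a (b @^-1` U) (g \o b)); last exact: mfun_reg.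
by apply: (proj1 (continuousP _) (@mfun_cont _ _ _ b)).
Qed.

Definition comp_morphism X Y Z (a : morphism X Y) (b : morphism Y Z) : morphism X Z :=
  Morphism (@comp_morphism_cont X Y Z a b) (@comp_morphism_reg X Y Z a b).

Variables (V : funSpace K) (f : V -> K) (l : nat).
Local Notation W := (cover_space f l).

(** Two morphisms to the covering agree where their projections to the base
    agree, which is closed, and where the difference of their roots vanishes,
    which is closed because this difference is a regular function. *)
Lemma cover_separated : Defs.separated V -> Defs.separated W.
Proof.
move=> sepV Z a b affZ.
have locZ : locally_affine Z by move=> z; exists setT.
have rtr (c : morphism Z W) : reg setT (@cover_root K V f l \o c).
  apply: (@mfun_reg _ _ _ c setT); first exact: openT.
  rewrite -(preimage_setT (cover_map f l)).
  by apply: poly_fun_reg; [exact: openT|exact: poly_fun_root].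
have -> : [set z | a z = b z] =
    [set z | comp_morphism a (cover_map f l) z = comp_morphism b (cover_map f l) z] `&`
    ~` (setT `&` [set z | cover_root (a z) - cover_root (b z) != 0]).
  rewrite predeqE => z; split=> [/= ->|[pE rE]].
    by split=> // -[_] /=; rewrite subrr eqxx.
  apply: cover_eq => //; apply/eqP; rewrite -subr_eq0; apply: contraT => nz.
  by case: rE; split.
apply: closedI; first exact: sepV.
apply: open_closedC; apply: nonzero_open => //; first exact: openT.
by apply: (reg_sub openT); exact: rtr.
Qed.

Lemma variety_locally_affine : variety V -> locally_affine V.
Proof.
move=> [[m [U [affU UV]]] _] x.
have : (\bigcup_i U i) x by rewrite UV.
by case=> i _ Ux; exists (U i).
Qed.

Lemma cover_variety : reg setT f -> variety V -> variety W.
Proof.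
move=> fr [[m [U [affU UV]]] sepV]; split; last exact: cover_separated.
exists m, (fun i => cover_map f l @^-1` U i); split=> [i|].
  by have [oU [n [phi chartU]]] := affU i; exact: (cover_affine _ fr oU chartU).
by rewrite -preimage_bigcup UV preimage_setT.
Qed.

End CoverVariety.

(** * Functions on the covering as polynomials in the root *)

Section RootsOfUnity.
Local Open Scope ring_scope.
Variables (K : closedFieldType) (l : nat).
Hypotheses (l_gt0 : (0 < l)%N) (l_unit : l%:R != 0 :> K).

Lemma prim_root_closed_field : exists z : K, l.-primitive_root z.
Proof.
have [r rE] := closed_field_poly_normal ('X^l - 1 : {poly K}).
have mon : ('X^l - 1 : {poly K}) \is monic by exact: monicXnsubC.
rewrite (monicP mon) scale1r in rE.
have sz : size r = l.
  by have := size_prod_XsubC r idfun; rewrite -rE /= size_XnsubC // => -[].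
suff /hasP[z _ zP] : has l.-primitive_root r by exists z.
apply: has_prim_root => //; last by rewrite sz.
- apply/allP => z zr; rewrite unity_rootE.
  have : root ('X^l - 1) z by rewrite rE root_prod_XsubC.
  by rewrite rootE hornerD hornerXn hornerN hornerC subr_eq0.
- by rewrite -separable_prod_XsubC -rE separable_Xn_sub_1.
Qed.

Lemma root_exists (c : K) : exists t, t ^+ l = c.
Proof.
have /closed_rootP[t] : size ('X^l - c%:P) != 1%N by rewrite size_XnsubC // eqSS -lt0n.
by rewrite rootE hornerD hornerXn hornerN hornerC subr_eq0 => /eqP; exists t.
Qed.

(** As [l] is invertible, a nonzero [c] has [l] distinct [l]-th roots. *)
Lemma coef_root_eq0 (p : {poly K}) (c : K) : c != 0 -> (size p <= l)%N ->
  (forall t, t ^+ l = c -> p.[t] = 0) -> p = 0.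
Proof.
move=> c0 sp p0; have [z zP] := prim_root_closed_field.
have [t tc] := root_exists c.
have t0 : t != 0.
  by apply: contraNneq c0 => t0; rewrite -tc t0 expr0n eqn0Ngt l_gt0.
apply/eqP; apply: contraT => pn0.
have := max_poly_roots (rs := [seq z ^+ i * t | i <- iota 0 l]) pn0.
rewrite size_map size_iota ltnNge sp; apply.
- apply/allP => _ /mapP[i _ ->]; apply/rootP/p0.
  by rewrite exprMn tc exprAC (prim_expr_order zP) expr1n mul1r.
- rewrite map_inj_in_uniq ?iota_uniq // => i j; rewrite !mem_iota /= !add0n => il jl.
  by move=> /(mulIf t0)/eqP; rewrite (eq_prim_root_expr zP) !modn_small // => /eqP.
Qed.

End RootsOfUnity.

Section NormalForm.
Local Open Scope ring_scope.
Local Open Scope classical_set_scope.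
Variables (K : closedFieldType) (V : funSpace K) (f : V -> K) (l : nat).
Local Notation pr := (@cover_proj K V f l).
Local Notation rt := (@cover_root K V f l).
Hypotheses (l_gt0 : (0 < l)%N) (l_unit : l%:R != 0 :> K).
Hypotheses (f_reg : reg setT f) (f0 : forall v, f v != 0).

Definition normal_form (U : set V) (P : root_cover f l -> K) (a : 'I_l -> V -> K) :=
  (forall i, reg U (a i)) /\
  forall w, U (pr w) -> P w = \sum_i a i (pr w) * rt w ^+ i.

Lemma cover_proj_surj v : exists w, pr w = v.
Proof.
have [t /eqP tl] := root_exists l_gt0 (f v).
by exists (@RootCover K V f l (v, t) tl).
Qed.

(** The fibre over [v] has [l] points, distinguished by the root, which is too
    many for a nonzero polynomial of degree less than [l]. *)
Lemma fibre_coef_eq0 v (a : 'I_l -> K) :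
  (forall w, pr w = v -> \sum_i a i * rt w ^+ i = 0) -> forall i, a i = 0.
Proof.
move=> a0 i; pose p := \poly_(i < l) (if insub i is Some j then a j else 0).
have : p = 0.
  apply: (coef_root_eq0 l_gt0 l_unit (f0 v)) (size_poly _ _) _ => t /eqP tl.
  rewrite -[RHS](a0 (@RootCover K V f l (v, t) tl) erefl) horner_poly.
  by apply: eq_bigr => j _; rewrite insubT //= => lj; congr (a _ * _); exact: val_inj.
move/polyP/(_ i); rewrite coef_poly ltn_ord coef0 insubT //= => li <-.
by congr a; exact: val_inj.
Qed.

Lemma fibre_coef_uniq v (a b : 'I_l -> K) :
  (forall w, pr w = v -> \sum_i a i * rt w ^+ i = \sum_i b i * rt w ^+ i) ->
  forall i, a i = b i.
Proof.
move=> ab i; apply/eqP; rewrite -subr_eq0; apply/eqP.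
apply: (@fibre_coef_eq0 v (fun i => a i - b i)) => w wv.
by under eq_bigr do rewrite mulrBl; rewrite sumrB ab // subrr.
Qed.

Let nfs U P := exists a, normal_form U P a.

Let nf_eq U P Q : (forall w, U (pr w) -> P w = Q w) -> nfs U P -> nfs U Q.
Proof. by move=> PQ [a [ar aE]]; exists a; split=> // w Uw; rewrite -PQ // aE. Qed.

Let nf_add U P Q : open U -> nfs U P -> nfs U Q -> nfs U (fun w => P w + Q w).
Proof.
move=> oU [a [ar aE]] [b [br bE]]; exists (fun i v => a i v + b i v).
split=> [i|w Uw]; first exact: reg_add.
by rewrite aE // bE // -big_split; apply: eq_bigr => i _; rewrite mulrDl.
Qed.

Let nf_sum U (I : Type) (r : seq I) (F : I -> root_cover f l -> K) :
  open U -> (forall i, nfs U (F i)) -> nfs U (fun w => \sum_(i <- r) F i w).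
Proof.
move=> oU Fn; elim: r => [|i r IH].
  exists (fun _ _ => 0); split=> [i|w _]; first exact: reg_cst.
  by rewrite big_nil big1 // => i _; rewrite mul0r.
by under eq_fun do rewrite big_cons; exact: nf_add.
Qed.

Let nf_monomial U a k : open U -> reg U a -> nfs U (fun w => a (pr w) * rt w ^+ k).
Proof.
move=> oU ar; have kl : (k %% l < l)%N by rewrite ltn_mod.
exists (fun i v => if i == Ordinal kl then a v * f v ^+ (k %/ l) else 0).
split=> [i|w Uw].
  case: eqP => _; last exact: reg_cst.
  apply: reg_mul => //; apply: reg_exp => //.
  exact: (reg_restr openT oU (@subsetT _ U) f_reg).
rewrite (bigD1 (Ordinal kl)) //= eqxx big1 ?addr0 => [|i /negPf->]; last by rewrite mul0r.
by rewrite {1}(divn_eq k l) exprD mulnC exprM cover_rootX mulrA.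
Qed.

(** Powers of the root of exponent at least [l] are reduced by t^l = f. *)
Lemma poly_fun_normal_form U P : open U -> poly_fun U P -> exists a, normal_form U P a.
Proof.
move=> oU; elim=> [a ar||P1 Q _ IHP _ IHQ|P1 Q _ [a [ar aE]] _ [b [br bE]]].
- by apply: nf_eq (nf_monomial 0%N oU ar) => w _; rewrite expr0 mulr1.
- by apply: nf_eq (nf_monomial 1%N oU (reg_cst 1 oU)) => w _; rewrite expr1 mul1r.
- exact: nf_add.
- apply: (@nf_eq U (fun w => \sum_i \sum_j a i (pr w) * b j (pr w) * rt w ^+ (i + j))).
    move=> w Uw; rewrite aE // bE // mulr_suml; apply: eq_bigr => i _.
    by rewrite mulr_sumr; apply: eq_bigr => j _; rewrite exprD; ring.
  apply: nf_sum => // i; apply: nf_sum => // j.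
  apply: (nf_monomial (a := fun v => a i v * b j v)) => //.
  exact: reg_mul.
Qed.

Lemma normal_form_poly_fun U (a : 'I_l -> V -> K) : open U -> (forall i, reg U (a i)) ->
  poly_fun U (fun w => \sum_i a i (pr w) * rt w ^+ i).
Proof.
move=> oU ar; apply: poly_fun_sum => // i; apply: poly_fun_mul.
  exact: (@poly_fun_base _ _ _ _ _ (a i)).
by apply: poly_fun_exp => //; exact: poly_fun_root.
Qed.

End NormalForm.

(** * The coordinate ring of the covering has no zero divisors *)

Section Germs.
Local Open Scope ring_scope.
Local Open Scope classical_set_scope.
Context {K : closedFieldType} {X : funSpace K}.

Definition lfun_of (U : set X) (x : X) (a : X -> K) (oU : open U) (Ux : U x)
    (ar : reg U a) : local_fun x.
Proof. by apply: (@LocalFun _ _ x a); apply/regular_atP; exists U. Defined.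

Variable x : X.

HB.instance Definition _ := GRing.RMorphism.copy (@germ K X x) (\pi_(stalk x))%qT.

Definition lfun_eval (y : X) (g : local_fun x) : K := g y.
Fact lfun_eval_zmod y : zmod_morphism (lfun_eval y). Proof. by []. Qed.
Fact lfun_eval_monoid y : monoid_morphism (lfun_eval y). Proof. by []. Qed.
HB.instance Definition _ y :=
  GRing.isZmodMorphism.Build _ _ (lfun_eval y) (lfun_eval_zmod y).
HB.instance Definition _ y :=
  GRing.isMonoidMorphism.Build _ _ (lfun_eval y) (lfun_eval_monoid y).

Lemma near_open (P : X -> Prop) : (\forall y \near x, P y) <->
  exists N, [/\ open N, N x & forall y, N y -> P y].
Proof.
split=> [xP|[N [oN Nx NP]]].
  have : nbhs x P := xP.
  by rewrite nbhsE => -[N [oN Nx] NP]; exists N.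
suff : nbhs x P by [].
by rewrite nbhsE; exists N.
Qed.

Lemma germ_eq (g h : local_fun x) : germ g = germ h <->
  exists N, [/\ open N, N x & forall y, N y -> g y = h y].
Proof. by rewrite germE near_open. Qed.

Lemma germ_eq0 (g : local_fun x) : germ g = 0 <->
  exists N, [/\ open N, N x & forall y, N y -> g y = 0].
Proof. by rewrite -(rmorph0 germ) germ_eq. Qed.

End Germs.

Section CoverIrreducible.
Local Open Scope ring_scope.
Local Open Scope classical_set_scope.
Variables (K : closedFieldType) (V : funSpace K) (f : V -> K) (l : nat).
Local Notation pr := (@cover_proj K V f l).
Local Notation rt := (@cover_root K V f l).
(* Up to degree 3, a polynomial without roots is irreducible. *)
Hypotheses (l_bounds : (1 < l <= 3)%N) (l_unit : l%:R != 0 :> K).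
Hypotheses (f_reg : reg setT f) (f0 : forall v, f v != 0).
Hypotheses (V_affine : locally_affine V) (V_irr : irreducible [set: V]).

Let l_gt0 : (0 < l)%N. Proof. by case/andP: l_bounds => /ltnW. Qed.

Lemma irreducible_prime_dvd (F : fieldType) (m p q : {poly F}) :
  irreducible_poly m -> m %| p * q -> (m %| p) || (m %| q).
Proof.
move=> m_irr mpq; have [cop|ncop] := boolP (coprimep m p).
  by rewrite Gauss_dvdpr // in mpq; rewrite mpq orbT.
have := m_irr.2 _ ncop (dvdp_gcdl m p) => /eqp_dvdl <-.
by rewrite dvdp_gcdr.
Qed.

Lemma XnsubC_irreducible (F : fieldType) (c : F) :
  (forall z, z ^+ l != c) -> irreducible_poly ('X^l - c%:P).
Proof.
move=> noroot; apply: cubic_irreducible.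
  by case/andP: l_bounds => _ l3; rewrite size_XnsubC // ltnS l_gt0.
by move=> z; rewrite rootE hornerD hornerXn hornerN hornerC subr_eq0.
Qed.

Variables (x : V) (D : idomainType) (e : {rmorphism stalk x -> D}).
Hypothesis e_inj : injective e.

Definition frac_germ : local_fun x -> {fraction D} := @tofrac D \o (e \o germ).
HB.instance Definition _ := GRing.RMorphism.on frac_germ.

Lemma frac_germ_eq0 g : frac_germ g = 0 <->
  exists N, [/\ open N, N x & forall y, N y -> g y = 0].
Proof.
rewrite -germ_eq0; split=> [/eqP|g0]; last by rewrite /frac_germ /= g0 !rmorph0.
by rewrite tofrac_eq0 -(rmorph0 e) => /eqP/e_inj.
Qed.

Let fx : local_fun x := lfun_of openT I f_reg.
Hypothesis not_power : forall z : {fraction D}, z ^+ l != frac_germ fx.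

(** Lift P and Q to polynomials p and q of degree less than [l] over the
    functions regular at [x].  The remainder of p q modulo X^l - f vanishes at
    all points of the fibres over U, hence its coefficients vanish on U, and
    X^l - f divides p q over the function field.  Being irreducible it divides
    p or q, which is then zero for degree reasons. *)
Lemma poly_fun_domain (U : set V) (P Q : root_cover f l -> K) :
  open U -> U x -> poly_fun U P -> poly_fun U Q ->
  (forall w, U (pr w) -> P w * Q w = 0) ->
  (forall w, U (pr w) -> P w = 0) \/ (forall w, U (pr w) -> Q w = 0).
Proof.
move=> oU Ux PP PQ PQ0.
have [a [ar aE]] := poly_fun_normal_form l_gt0 f_reg oU PP.
have [b [br bE]] := poly_fun_normal_form l_gt0 f_reg oU PQ.
pose lp (c : 'I_l -> V -> K) (cr : forall i, reg U (c i)) : {poly local_fun x} :=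
  \poly_(i < l) (if insub i is Some j then lfun_of oU Ux (cr j) else 0).
have lpE c cr v t : (map_poly (lfun_eval v) (lp c cr)).[t] = \sum_i c i v * t ^+ i.
  have mapE (G : nat -> local_fun x) : map_poly (lfun_eval v) (\poly_(i < l) G i) =
      \poly_(i < l) lfun_eval v (G i).
    apply/polyP => i; rewrite coef_map !coef_poly.
    by case: ifP => // _; rewrite rmorph0.
  rewrite /lp mapE horner_poly; apply: eq_bigr => i _.
  rewrite insubT //= => li; congr (_ * _); rewrite /lfun_eval /=; congr (c _ _).
  exact: val_inj.
have lp0 c cr : map_poly frac_germ (lp c cr) = 0 ->
    forall w, U (pr w) -> \sum_i c i (pr w) * rt w ^+ i = 0.
  move=> /polyP c0 w Uw; rewrite big1 // => i _.
  have := c0 i; rewrite coef_map coef0 coef_poly ltn_ord insubT //= => li.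
  have -> : Sub (nat_of_ord i) li = i by exact: val_inj.
  move=> /frac_germ_eq0[N [oN Nx N0]].
  rewrite (reg_eq_dense V_affine V_irr (N := N) (g := fun=> 0) oU) ?mul0r //.
  - exact: reg_cst.
  - by exists x.
  - by move=> y _ /N0.
set p := lp a ar; set q := lp b br.
pose m : {poly local_fun x} := 'X^l - fx%:P.
have m_monic : m \is monic by exact: monicXnsubC.
have pqE := Pdiv.RingMonic.rdivp_eq m_monic (p * q).
set d := Pdiv.Ring.rdivp _ _ in pqE; set r := Pdiv.Ring.rmodp _ _ in pqE.
have sr : (size r <= l)%N.
  by rewrite -ltnS -(size_XnsubC fx l_gt0) Pdiv.Ring.ltn_rmodp monic_neq0.
have r0 v : U v -> map_poly (lfun_eval v) r = 0.
  move=> Uv; apply: (coef_root_eq0 l_gt0 l_unit (f0 v)).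
    by apply: leq_trans sr; exact: size_poly.
  move=> t /eqP tl; pose w := @RootCover K V f l (v, t) tl.
  have := congr1 (fun s => (map_poly (lfun_eval v) s).[t]) pqE.
  rewrite /= rmorphM hornerM !lpE rmorphD hornerD rmorphM hornerM.
  rewrite /m rmorphB /= map_polyXn map_polyC hornerD hornerXn hornerN hornerC.
  rewrite {3}/lfun_eval /= (eqP tl) subrr mulr0 add0r => <-.
  by rewrite -(aE w) // -(bE w) // PQ0.
have r00 : map_poly frac_germ r = 0.
  apply/polyP => i; rewrite coef_map coef0; apply/frac_germ_eq0.
  exists U; split=> // v Uv.
  by have /polyP/(_ i) := r0 v Uv; rewrite coef_map coef0.
have := XnsubC_irreducible not_power => /irreducible_prime_dvd.
move=> /(_ (map_poly frac_germ p) (map_poly frac_germ q)).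
have -> : 'X^l - (frac_germ fx)%:P = map_poly frac_germ m.
  by rewrite rmorphB /= map_polyXn map_polyC.
have -> : map_poly frac_germ p * map_poly frac_germ q =
    map_poly frac_germ d * map_poly frac_germ m.
  rewrite -[LHS]rmorphM -[RHS]rmorphM pqE [LHS]rmorphD /=.
  by rewrite r00 addr0.
rewrite dvdp_mull // => /(_ isT).
have small c cr : map_poly frac_germ m %| map_poly frac_germ (lp c cr) ->
    map_poly frac_germ (lp c cr) = 0.
  move=> mdvd; apply/eqP; apply: contraT => c0; have := dvdp_leq c0 mdvd.
  have -> : map_poly frac_germ m = 'X^l - (frac_germ fx)%:P.
    by rewrite rmorphB /= map_polyXn map_polyC.
  rewrite size_XnsubC // ltnNge.
  by rewrite (leq_trans (size_poly _ _)) // (leq_trans (size_poly _ _)).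
case/orP=> /small/lp0 z0; [left|right] => w Uw; [rewrite aE//|rewrite bE//]; exact: z0.
Qed.

End CoverIrreducible.

(** * A root in the function field is a global regular function *)

Section RationalRoot.
Local Open Scope ring_scope.
Local Open Scope classical_set_scope.

Lemma fraction_repr (D : idomainType) (z : {fraction D}) :
  exists n d : D, d != 0 /\ z * tofrac d = tofrac n.
Proof.
exists (frac (repr z)).1, (frac (repr z)).2; split; first exact: denom_ratioP.
rewrite -[z in LHS]reprK; unlock FracField.tofrac.
rewrite -[LHS]FracField.pi_mul; apply/eqmodP => /=.
have d1 : (1 : D) != 0 by exact: oner_neq0.
rewrite /FracField.equivf /FracField.mulf !numden_Ratio ?mulf_neq0 ?denom_ratioP //.
by rewrite !mulr1 reprK mulrC.
Qed.

Variables (K : closedFieldType) (V : funSpace K) (l : nat).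
Hypothesis l_gt0 : (0 < l)%N.
Hypotheses (V_affine : locally_affine V) (V_irr : irreducible [set: V]).
Hypothesis V_normal : Defs.normal V.

Lemma integral_root (D : idomainType) (a b c : D) :
  (forall z : {fraction D}, integralOver (@tofrac D) z -> exists d, z = tofrac d) ->
  b != 0 -> a ^+ l = c * b ^+ l -> exists d, a = d * b.
Proof.
move=> D_normal b0 ab; have b0' : tofrac b != 0 by rewrite tofrac_eq0.
have [|d dE] := D_normal (tofrac a / tofrac b).
  exists ('X^l - c%:P); first exact: monicXnsubC.
  rewrite rmorphB /= map_polyXn map_polyC rootE hornerD hornerXn hornerN hornerC subr_eq0.
  by rewrite expr_div_n -!rmorphXn ab rmorphM /= mulfK // rmorphXn expf_neq0.
exists d; apply/eqP; rewrite -tofrac_eq rmorphM /= -dE divfK //.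
Qed.

(** At each point [x] the rational function p / q is a quotient of two elements
    of the local ring, namely polynomials r and s in the coordinates of an
    affine neighbourhood.  It is integral over that ring, being an [l]-th root of
    [f], hence belongs to it by normality.  The functions so obtained at the
    various points all coincide generically with p / q, hence agree where they
    are both defined, and glue. *)
Lemma rational_root (f : V -> K) (N0 : set V) (p q : V -> K) :
  reg setT f -> open N0 -> reg N0 p -> reg N0 q ->
  (exists2 y, N0 y & q y != 0) ->
  (forall y, N0 y -> p y ^+ l = f y * q y ^+ l) ->
  exists2 g, reg setT g & forall v, g v ^+ l = f v.
Proof.
move=> fr oN0 pr qr [y0 N0y0 qy0] pqf.
have reg_dense := reg_eq_dense V_affine V_irr.
(* g is regular on N and generically equal to p / q. *)
pose good N g := [/\ open N, reg N g &
  exists M, [/\ open M, M !=set0, M `<=` N0 & forall y, M y -> q y != 0 /\ g y * q y = p y]].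
have goodE N g N' g' y : good N g -> good N' g' -> N y -> N' y -> g y = g' y.
  move=> [oN gr [M [oM M0 MN gE]]] [oN' gr' [M' [oM' M0' MN' gE']]] Ny Ny'.
  have oNN : open (N `&` N') by exact: openI.
  apply: (reg_dense (N `&` N') (M `&` M')) => //.
  - exact: openI.
  - by apply: reg_restr gr => // z [].
  - by apply: reg_restr gr' => // z [].
  - apply: (irreducible_meet V_irr) => //; try exact: openI.
      by exists y.
    exact: (irreducible_meet V_irr).
  - move=> z _ [Mz Mz']; have [qz gz] := gE z Mz; have [_ gz'] := gE' z Mz'.
    by apply: (mulIf qz); rewrite gz gz'.
have local x : exists N g, N x /\ good N g.
  have [U Ux [oU [n [phi chartU]]]] := V_affine x.
  have oQ := nonzero_open V_affine oN0 qr.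
  have [y [Uy [N0y qy]]] : (U `&` (N0 `&` [set y | q y != 0])) !=set0.
    by apply: (irreducible_meet V_irr) => //; [exists x | exists y0].
  have [p1 [p2 [p2y pE]]] := chart_reg oU chartU oN0 pr Uy N0y.
  have [q1 [q2 [q2y qE]]] := chart_reg oU chartU oN0 qr Uy N0y.
  pose r v := (p1 * q2).@[phi v]; pose s v := (p2 * q1).@[phi v].
  have rr : reg U r by exact: chart_poly_reg.
  have sr : reg U s by exact: chart_poly_reg.
  pose M := U `&` [set v | (p2 * (q1 * q2)).@[phi v] != 0].
  have oM : open M by exact: chart_open.
  have q1y : q1.@[phi y] != 0.
    have [_ qyE] := qE y Uy q2y; apply: contraNneq qy => q10.
    by rewrite qyE q10 mul0r.
  have My : M y by split=> //=; rewrite !mevalM !mulf_neq0.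
  have MP v : M v -> [/\ N0 v, s v != 0, q v != 0 & r v * q v = p v * s v].
    case=> Uv /=; rewrite !mevalM !mulf_eq0 !negb_or => /and3P[p2v q1v q2v].
    have [N0v ->] := pE v Uv p2v; have [_ ->] := qE v Uv q2v.
    rewrite /r /s !mevalM !mulf_neq0 ?invr_eq0 //; split=> //.
    by field; rewrite p2v q2v.
  have rsf v : U v -> r v ^+ l = f v * s v ^+ l.
    have frU : reg U f by apply: reg_restr fr => //; exact: openT.
    apply: (reg_dense U M (fun v => r v ^+ l) (fun v => f v * s v ^+ l)) => //.
    - exact: reg_exp.
    - by apply: reg_mul => //; exact: reg_exp.
    - by exists y.
    move=> u Uu /MP[N0u su qu rE]; apply: (mulIf (expf_neq0 l qu)).
    by rewrite -exprMn rE exprMn pqf // mulrAC.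
  have [D [e [[e' eK e'K] D_normal]]] := V_normal x.
  pose rx := lfun_of oU Ux rr; pose sx := lfun_of oU Ux sr.
  pose fx := lfun_of openT (I : setT x) fr.
  have sx0 : e (germ sx) != 0.
    apply/eqP => s0; have : germ sx = 0 by rewrite -(eK (germ sx)) s0 -(rmorph0 e) eK.
    move=> /germ_eq0[N [oN Nx sN]]; have [_ sy _ _] := MP y My.
    suff : s y = 0 by move/eqP; rewrite (negPf sy).
    apply: (reg_dense U N s (fun=> 0)) => //; [exact: reg_cst|by exists x|].
    by move=> v _ /sN.
  have [|d dE] := @integral_root D (e (germ rx)) (e (germ sx)) (e (germ fx)) D_normal sx0.
    have rsE : germ (rx ^+ l) = germ (fx * sx ^+ l).
      apply/germ_eq; exists U; split=> // v Uv.
      rewrite -[LHS]/(lfun_eval v (rx ^+ l)) -[RHS]/(lfun_eval v (fx * sx ^+ l)).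
      by rewrite rmorphM !rmorphXn; exact: rsf.
    transitivity (e (germ (rx ^+ l))); first by rewrite !rmorphXn.
    by rewrite rsE !rmorphM !rmorphXn.
  have [g gE] : exists g : local_fun x, d = e (germ g).
    by exists (repr (e' d)); rewrite /germ reprK e'K.
  have /regular_atP[N [oN Nx] gr] := valP g.
  have [N' [oN' N'x rgs]] : exists N, [/\ open N, N x & forall y, N y -> rx y = (g * sx) y].
    by apply/germ_eq; apply: (can_inj eK); rewrite dE gE !rmorphM.
  have oNN : open (N `&` N') by exact: openI.
  exists (N `&` N'), g; split=> //; split=> //.
    by apply: reg_restr gr => // z [].
  exists (M `&` (N `&` N')); split.
  - exact: openI.
  - by apply: (irreducible_meet V_irr) => //; [exists y|exists x].
  - by move=> z [/MP[]].
  move=> z [/MP[_ sz qz rE] [_ N'z]]; split=> //; apply: (mulIf sz).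
  by rewrite -rE mulrAC; congr (_ * _); rewrite [RHS]rgs.
have [N /choice[g gP]] := choice local.
have g_good x N' g' : good N' g' -> N' x -> g x x = g' x.
  by move=> good' Nx'; have [Nx goodx] := gP x; exact: (goodE _ _ _ _ _ goodx good').
exists (fun x => g x x).
  apply: reg_local => x _; exists (N x), (g x); have [Nx [oN gr M]] := gP x; split=> //.
  by move=> y Ny; apply: (g_good y (N x) (g x)).
move=> v; have [Nv [oN gr [M [oM M0 MN gE]]]] := gP v.
have fN : reg (N v) f by apply: reg_restr fr => //; exact: openT.
apply: (reg_dense (N v) M (fun y => g v y ^+ l) f) => //; first exact: reg_exp.
  by apply: (irreducible_meet V_irr) => //; exists v.
move=> y _ My; have [qy gyE] := gE y My.
by apply: (mulIf (expf_neq0 l qy)); rewrite -exprMn gyE pqf //; exact: MN.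
Qed.

End RationalRoot.

(** * Finiteness of the covering *)

Section CoverFinite.
Local Open Scope ring_scope.
Local Open Scope classical_set_scope.

Lemma open_forall (T : topologicalType) (I : finType) (F : I -> set T) :
  (forall i, open (F i)) -> open [set x | forall i, F i x].
Proof.
move=> oF; rewrite openE => x Fx.
by apply: filter_forall => i; apply: open_nbhs_nbhs; split; [exact: oF | exact: Fx].
Qed.

Variables (K : closedFieldType) (V : funSpace K) (f : V -> K) (l : nat).
Local Notation pr := (@cover_proj K V f l).
Local Notation rt := (@cover_root K V f l).
Hypotheses (l_gt0 : (0 < l)%N) (l_unit : l%:R != 0 :> K).
Hypotheses (f_reg : reg setT f) (f0 : forall v, f v != 0).
Hypothesis V_affine : locally_affine V.

Variable z : K.
Hypothesis z_prim : l.-primitive_root z.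

Fact deck_subproof k (w : root_cover f l) : (z ^+ k * rt w) ^+ l == f (pr w).
Proof. by rewrite exprMn exprAC (prim_expr_order z_prim) expr1n mul1r cover_rootX. Qed.

(** The deck transformations of the covering, indexed by the powers of the root
    of unity [z]. *)
Definition deck k w : root_cover f l :=
  @RootCover K V f l (pr w, z ^+ k * rt w) (deck_subproof k w).

Lemma deck_proj k w : pr (deck k w) = pr w. Proof. by []. Qed.
Lemma deck_root k w : rt (deck k w) = z ^+ k * rt w. Proof. by []. Qed.

Lemma deck0 w : deck 0 w = w.
Proof. by apply: cover_eq => //; rewrite deck_root expr0 mul1r. Qed.

Lemma deck_ordS (k : 'I_l) w : deck k (deck 1 w) = deck (ordS k) w.
Proof.
apply: cover_eq => //; rewrite !deck_root mulrA -exprD /=.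
by rewrite (prim_expr_mod z_prim) addn1.
Qed.

Lemma poly_fun_deck U P k : open U -> poly_fun U P -> poly_fun U (P \o deck k).
Proof.
move=> oU; elim=> [a ar||P1 Q _ IHP _ IHQ|P1 Q _ IHP _ IHQ].
- exact: (@poly_fun_base _ _ f l U a).
- by apply: poly_fun_mul; [exact: poly_fun_cst | exact: poly_fun_root].
- exact: poly_fun_add.
- exact: poly_fun_mul.
Qed.

Lemma cover_root_neq0 w : rt w != 0.
Proof.
apply: contraNneq (f0 (pr w)) => w0.
by rewrite -cover_rootX w0 expr0n eqn0Ngt l_gt0.
Qed.

(** The norm of [Q] is invariant under deck transformations, which multiply the
    coefficient of t^i by z^i; so only its constant coefficient survives. *)
Lemma norm_on_base U Q : open U -> poly_fun U Q ->
  exists2 b : V -> K, reg U b &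
    forall w, U (pr w) -> \prod_(k < l) Q (deck k w) = b (pr w).
Proof.
move=> oU PQ; pose N w := \prod_(k < l) Q (deck k w).
have PN : poly_fun U N by apply: poly_fun_prod => // k; exact: poly_fun_deck.
have [b [br bE]] := poly_fun_normal_form l_gt0 f_reg oU PN.
have Ninv w : N (deck 1 w) = N w.
  rewrite /N [RHS](reindex (@ordS l)); last exact/onW_bij/ordS_bij.
  by apply: eq_bigr => k _; rewrite deck_ordS.
exists (b (Ordinal l_gt0)) => // w Uw; rewrite -/(N w) bE //.
rewrite (bigD1 (Ordinal l_gt0)) //= expr0 mulr1 big1 ?addr0 // => i i0.
have bz : b i (pr w) * z ^+ i = b i (pr w).
  apply: (@fibre_coef_uniq _ _ f l l_gt0 l_unit f0 (pr w)
    (fun i => b i (pr w) * z ^+ i) (fun i => b i (pr w))) => w' w'w.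
  have Uw' : U (pr w') by rewrite w'w.
  rewrite -[in RHS]w'w -bE // -Ninv bE // deck_proj w'w.
  by apply: eq_bigr => j _; rewrite deck_root expr1 exprMn mulrA.
have z1 : z ^+ i - 1 != 0.
  rewrite subr_eq0 -(prim_order_dvd z_prim) gtnNdvd //.
  by rewrite lt0n; apply: contraNneq i0 => i0; apply/eqP/val_inj.
have /eqP : b i (pr w) * (z ^+ i - 1) = 0 by rewrite mulrBr bz mulr1 subrr.
by rewrite mulf_eq0 (negPf z1) orbF => /eqP->; rewrite mul0r.
Qed.

(** Along the fibre over [v], [h] has local expressions P_k / Q_k, one near each
    point, and each Q_k may vanish at the other points.  Interpolating, let E_k
    be a polynomial in the root vanishing at all points of the fibre but the
    k-th; then \sum_k E_k Q_k^2 is a denominator of [h] which vanishes nowhere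
    on the fibre.  The squares make h Q_k^2 = P_k Q_k hold also where Q_k
    vanishes. *)
Lemma fibre_denominator (U : set V) h v : open U -> U v ->
  cover_reg (fun w => U (pr w)) h ->
  exists U0 P Q, [/\ open U0, U0 v /\ U0 `<=` U, poly_fun U0 P, poly_fun U0 Q &
    (forall w, pr w = v -> Q w != 0) /\ forall w, U0 (pr w) -> h w * Q w = P w].
Proof.
move=> oU Uv hr; have [w0 w0v] := cover_proj_surj f l_gt0 v.
have Uk (k : 'I_l) : U (pr (deck k w0)) by rewrite deck_proj w0v.
have /choice[G GP] : forall k : 'I_l,
    exists G : set V * (root_cover f l -> K) * (root_cover f l -> K),
    [/\ open G.1.1, G.1.1 v, poly_fun G.1.1 G.1.2, poly_fun G.1.1 G.2 &
      G.2 (deck k w0) != 0 /\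
      forall w', U (pr w') -> G.1.1 (pr w') -> G.2 w' != 0 -> h w' = G.1.2 w' / G.2 w'].
  move=> k; have [U' [P [Q [oU' U'w PP PQ hE]]]] := hr _ (Uk k).
  by exists (U', P, Q); split=> //; rewrite -w0v.
pose U0 := U `&` [set y | forall k, (G k).1.1 y].
have oU0 : open U0.
  by apply: openI => //; apply: open_forall => k; have [] := GP k.
have sub k : U0 `<=` (G k).1.1 by move=> y [_]; exact.
pose E k (w : root_cover f l) := \prod_(j < l | j != k) (rt w + - (z ^+ j * rt w0)).
have PE k : poly_fun U0 (E k).
  apply: poly_fun_prod => // j; apply: poly_fun_add; first exact: poly_fun_root.
  exact: poly_fun_cst.
have PGP k : poly_fun U0 (G k).1.2.
  by have [oG _ PP _ _] := GP k; apply: poly_fun_restr PP.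
have PGQ k : poly_fun U0 (G k).2.
  by have [oG _ _ PQ _] := GP k; apply: poly_fun_restr PQ.
exists U0, (fun w => \sum_k E k w * ((G k).1.2 w * (G k).2 w)),
  (fun w => \sum_k E k w * ((G k).2 w * (G k).2 w)); split=> //.
- by split=> [|y []//]; split=> // k; have [] := GP k.
- by apply: poly_fun_sum => // k; apply: poly_fun_mul => //; exact: poly_fun_mul.
- by apply: poly_fun_sum => // k; apply: poly_fun_mul => //; exact: poly_fun_mul.
split=> [w wv|w [Uw Gw]]; last first.
  rewrite mulr_sumr; apply: eq_bigr => k _; rewrite mulrCA; congr (_ * _).
  have [_ _ _ _ [_ hE]] := GP k.
  have [->|Qw] := eqVneq ((G k).2 w) 0; first by rewrite !mulr0.
  by rewrite (hE w Uw (Gw k) Qw) mulrA divfK.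
have w00 := cover_root_neq0 w0.
have /(prim_rootP z_prim)[k kE] : (rt w / rt w0) ^+ l = 1.
  by rewrite expr_div_n !cover_rootX wv w0v divff.
have wE : w = deck k w0.
  by apply: cover_eq; rewrite ?wv ?deck_proj ?w0v // deck_root -kE divfK.
rewrite (bigD1 k) //= big1 => [|j jk]; last first.
  by rewrite /E (bigD1 k) 1?eq_sym //= wE deck_root subrr !mul0r.
have [_ _ _ _ [Qw _]] := GP k; rewrite addr0 wE !mulf_neq0 //.
rewrite /E; apply/prodf_neq0 => j jk.
rewrite deck_root subr_eq0 (inj_eq (mulIf w00)) (eq_prim_root_expr z_prim).
by rewrite !modn_small // eq_sym.
Qed.

(** A denominator Q of [h] without zeros on the fibre can be made to come from
    the base: multiply by the other conjugates of Q and divide by the norm. *)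
Lemma regular_normal_form_local (U : set V) h v : open U -> U v ->
  cover_reg (fun w => U (pr w)) h ->
  exists U1 b, [/\ open U1, U1 v, U1 `<=` U & @normal_form K V f l U1 h b].
Proof.
move=> oU Uv hr.
have [U0 [P [Q [oU0 [U0v U0U] PP PQ [Q0 hQ]]]]] := fibre_denominator oU Uv hr.
have [N Nr NE] := norm_on_base oU0 PQ.
pose R w := \prod_(k < l | k != Ordinal l_gt0) Q (deck k w).
have QR w : Q w * R w = \prod_(k < l) Q (deck k w).
  by rewrite [RHS](bigD1 (Ordinal l_gt0)) //= deck0.
pose U1 := U0 `&` [set y | N y != 0].
have oU1 : open U1 by exact: nonzero_open.
have U10 : U1 `<=` U0 by move=> y [].
have PR : poly_fun U0 R by apply: poly_fun_prod => // k; exact: poly_fun_deck.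
have Ph : poly_fun U1 (fun w => (N (pr w))^-1 * (P w * R w)).
  apply: poly_fun_mul.
    exact: (@poly_fun_base _ _ f l U1 (fun y => (N y)^-1) (reg_inv V_affine oU0 Nr)).
  by apply: poly_fun_mul; [exact: poly_fun_restr PP|exact: poly_fun_restr PR].
have [b [br bE]] := poly_fun_normal_form l_gt0 f_reg oU1 Ph.
exists U1, b; split=> //.
- split=> //=; have [w wv] := cover_proj_surj f l_gt0 v.
  rewrite -wv -NE; last by rewrite wv.
  by apply/prodf_neq0 => k _; exact: Q0.
- by move=> y /U10/U0U.
split=> // w U1w; have [U0w N0] := U1w; rewrite -bE // -hQ // -mulrA QR NE //.
by rewrite mulrCA mulVf // mulr1.
Qed.

(** The local normal forms glue, since the coefficients are determined by [h]
    fibre by fibre. *)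
Lemma regular_normal_form (U : set V) h : open U ->
  cover_reg (fun w => U (pr w)) h -> exists a, @normal_form K V f l U h a.
Proof.
move=> oU hr.
have /choice[G GP] : forall v, exists G : set V * ('I_l -> V -> K), U v ->
    [/\ open G.1, G.1 v, G.1 `<=` U & normal_form G.1 h G.2].
  move=> v; have [Uv|nUv] := pselect (U v); last by exists (setT, fun _ _ => 0).
  have [U1 [b bP]] := regular_normal_form_local oU Uv hr.
  by exists (U1, b).
have GE v y : U v -> (G v).1 y -> forall i, (G y).2 i y = (G v).2 i y.
  move=> Uv Gy; have [_ _ GU [_ GvE]] := GP v Uv; have Uy := GU y Gy.
  have [_ Gyy _ [_ GyE]] := GP y Uy.
  apply: (@fibre_coef_uniq _ _ f l l_gt0 l_unit f0 y
    (fun i => (G y).2 i y) (fun i => (G v).2 i y)) => w wy.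
  by transitivity (h w); [rewrite GyE wy|rewrite GvE wy].
exists (fun i v => (G v).2 i v); split=> [i|w Uw].
  apply: reg_local => v Uv; have [oG Gv GU [br _]] := GP v Uv.
  by exists (G v).1, ((G v).2 i); split=> // y Gy; exact: GE.
by have [_ Gw _ [_ GwE]] := GP _ Uw; exact: GwE.
Qed.

Lemma cover_finite : finite_morphism (cover_map f l).
Proof.
move=> y; have [U Uy affU] := V_affine y; have [oU [n [phi chartU]]] := affU.
exists U; split=> //; first exact: (cover_affine _ f_reg oU chartU).
exists l, (fun i w => rt w ^+ i); split=> [i|h hr].
  by apply: poly_fun_reg => //; apply: poly_fun_exp => //; exact: poly_fun_root.
have [a [ar aE]] := regular_normal_form oU hr.
by exists a.
Qed.

End CoverFinite.

(** * The covering is irreducible and étale *)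

Section CoverEtale.
Local Open Scope ring_scope.
Local Open Scope classical_set_scope.
Variables (K : closedFieldType) (V : funSpace K) (f : V -> K) (l : nat).
Local Notation W := (cover_space f l).
Local Notation pr := (@cover_proj K V f l).
Local Notation rt := (@cover_root K V f l).
Local Notation pi := (cover_map f l).
Hypotheses (l_gt0 : (0 < l)%N) (l_unit : l%:R != 0 :> K).
Hypotheses (f_reg : reg setT f) (f0 : forall v, f v != 0).
Hypotheses (V_affine : locally_affine V) (V_irr : irreducible [set: V]).
(* The O(U)-algebra generated by the root has no zero divisors. *)
Hypothesis domain : forall (U : set V) (P Q : root_cover f l -> K),
  open U -> U !=set0 -> poly_fun U P -> poly_fun U Q ->
  (forall w, U (pr w) -> P w * Q w = 0) ->
  (forall w, U (pr w) -> P w = 0) \/ (forall w, U (pr w) -> Q w = 0).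

(** If W were the union of two proper closed subsets, functions P and Q
    vanishing on either, but not identically, would have product zero over some
    nonempty open set of the base. *)
Lemma cover_irreducible : irreducible [set: W].
Proof.
have [[v _] _] := V_irr; have [w _] := cover_proj_surj f l_gt0 v.
split; first by exists w.
move=> A B cA cB AB; apply: contrapT => /not_orP[nA nB].
have [w1 [_ Aw1]] : exists w, setT w /\ ~ A w.
  apply: contrapT => nex; apply: nA => w1 _; apply: contrapT => Aw1.
  by apply: nex; exists w1.
have [w2 [_ Bw2]] : exists w, setT w /\ ~ B w.
  apply: contrapT => nex; apply: nB => w2 _; apply: contrapT => Bw2.
  by apply: nex; exists w2.
have [U [P [oU Uw1 PP Pw1 PA]]] := (closed_openC cA : cover_open (~` A)) w1 Aw1.
have [U' [Q [oU' Uw2 PQ Qw2 QB]]] := (closed_openC cB : cover_open (~` B)) w2 Bw2.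
have oUU : open (U `&` U') by exact: openI.
have UU0 : (U `&` U') !=set0.
  by apply: (irreducible_meet V_irr) => //; [exists (pr w1)|exists (pr w2)].
have extend U0 R : open U0 -> U `&` U' `<=` U0 -> poly_fun U0 R ->
    (forall w, (U `&` U') (pr w) -> R w = 0) -> forall w, U0 (pr w) -> R w = 0.
  move=> oU0 sub PR R0 w' Uw'; have [a [ar aE]] := poly_fun_normal_form l_gt0 f_reg oU0 PR.
  rewrite aE // big1 // => i _.
  rewrite (reg_eq_dense V_affine V_irr (g := fun=> 0) (N := U `&` U') oU0) ?mul0r //.
  - exact: reg_cst.
  - by case: UU0 => y Uy; exists y; split=> //; exact: sub.
  - move=> y _ Uy; apply: (@fibre_coef_eq0 _ _ f l l_gt0 l_unit f0 y (fun i => a i y)).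
    by move=> w'' wy; rewrite -{1}wy -aE ?R0 ?wy //; apply: sub.
have [| |w' [Uw' Uw'']|P0|Q0] :=
  @domain (U `&` U') P Q oUU UU0.
- by apply: poly_fun_restr PP => // y [].
- by apply: poly_fun_restr PQ => // y [].
- apply/eqP; apply: contraT; rewrite mulf_eq0 negb_or => /andP[Pw' Qw'].
  by case: (AB w' I) => [/(PA w' Uw' Pw')|/(QB w' Uw'' Qw')].
- by move: Pw1; rewrite (extend U P oU _ PP P0) ?eqxx // => y [].
- by move: Qw2; rewrite (extend U' Q oU' _ PQ Q0) ?eqxx // => y [].
Qed.

Section AtPoint.
Variable w : W.

Lemma cover_lfun_quot U P Q : open U -> U (pr w) -> poly_fun U P -> poly_fun U Q ->
  Q w != 0 -> exists g : local_fun w, forall w', g w' = P w' / Q w'.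
Proof.
move=> oU Uw PP PQ Qw.
pose O : set W := [set w' | U (pr w') /\ Q w' != 0].
have oO : open O by exact: basic_open.
by exists (@lfun_of _ W O w _ oO (conj Uw Qw) (poly_fun_quot_reg oU PP PQ (@subset_refl _ O))).
Qed.

Lemma cover_lfun U P : open U -> U (pr w) -> poly_fun U P ->
  exists g : local_fun w, forall w', g w' = P w'.
Proof.
move=> oU Uw PP; have [|g gE] := cover_lfun_quot oU Uw PP (@poly_fun_cst _ _ f l U 1 oU).
  exact: oner_neq0.
by exists g => w'; rewrite gE divr1.
Qed.

Lemma local_fun_quot (g : local_fun w) : exists U P Q,
  [/\ open U, U (pr w), poly_fun U P, poly_fun U Q & Q w != 0 /\
    exists N : set W, [/\ open N, N w &
      forall w', N w' -> [/\ U (pr w'), Q w' != 0 & g w' = P w' / Q w']]].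
Proof.
have /regular_atP[N [oN Nw] gr] := valP g.
have [U [P [Q [oU Uw PP PQ [Qw gE]]]]] := gr w Nw.
exists U, P, Q; split=> //; split=> //.
exists (N `&` [set w' | U (pr w') /\ Q w' != 0]); split=> //.
  by apply: openI => //; exact: basic_open.
by move=> w' [Nw' [Uw' Qw']]; split=> //; exact: gE.
Qed.

Let eg (k : 'I_l) : local_fun w :=
  projT1 (cid (cover_lfun openT I (poly_fun_exp k openT (poly_fun_root f l setT)))).

Let egE k w' : eg k w' = rt w' ^+ k.
Proof. by rewrite /eg; case: cid => g /= ->. Qed.

Let e (k : 'I_l) : stalk w := germ (eg k).

(* The elements of the local ring of the covering without denominators. *)
Let span := in_span (pullback pi w) e.

Let span_sum (a : 'I_l -> local_fun (pi w)) (g : local_fun w) :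
  \sum_k pullback pi w (germ (a k)) * e k = germ g <->
  exists N : set W, [/\ open N, N w &
    forall w', N w' -> \sum_k a k (pr w') * rt w' ^+ k = g w'].
Proof.
have -> : \sum_k pullback pi w (germ (a k)) * e k =
    germ (\sum_k lfun_comp (a k) * eg k) :> stalk w.
  by rewrite rmorph_sum; apply: eq_bigr => k _; rewrite rmorphM pullback_germ.
rewrite germ_eq; have sumE w' : (\sum_k lfun_comp (a k) * eg k) w' =
    \sum_k a k (pr w') * rt w' ^+ k.
  rewrite -[LHS]/(lfun_eval w' _) rmorph_sum; apply: eq_bigr => k _.
  by rewrite rmorphM; congr (_ * _); exact: egE.
by split=> -[N [oN Nw NE]]; exists N; split=> // w' Nw'; rewrite -NE.
Qed.

Let span_germ (g : local_fun w) : span (germ g) <-> exists U P,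
  [/\ open U, U (pr w), poly_fun U P & exists N : set W, [/\ open N, N w &
    forall w', N w' -> g w' = P w']].
Proof.
split=> [[a aE]|[U [P [oU Uw PP [N [oN Nw gP]]]]]].
  pose b k := repr (a k) : local_fun (pi w).
  have ab k : a k = germ (b k) by rewrite /germ /b reprK.
  have /span_sum[N [oN Nw NE]] : \sum_k pullback pi w (germ (b k)) * e k = germ g.
    by rewrite aE; apply: eq_bigr => k _; rewrite -ab.
  have /choice[G GP] k : exists G, [/\ open G, G (pr w) & reg G (b k)].
    by have /regular_atP[G [oG Gw] br] := valP (b k); exists G.
  pose U := [set y | forall k, G k y].
  have oU : open U by apply: open_forall => k; have [] := GP k.
  exists U, (fun w' => \sum_k b k (pr w') * rt w' ^+ k); split=> //.
  - by move=> k; have [] := GP k.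
  - apply: (@normal_form_poly_fun K V f l U (fun k => b k)) => // k.
    by have [oG _ br] := GP k; apply: reg_restr br.
  - by exists N; split=> // w' Nw'; rewrite -NE.
have [a [ar aE]] := poly_fun_normal_form l_gt0 f_reg oU PP.
exists (fun k => germ (lfun_of oU Uw (ar k))); symmetry; apply/span_sum.
exists (N `&` (pi @^-1` U)); split=> //.
  by apply: openI => //; exact: (proj1 (continuousP _) (@cover_proj_cont _ _ f l)).
by move=> w' [Nw' Uw']; rewrite gP // aE.
Qed.

Let e_free (a : 'I_l -> stalk (pi w)) :
  \sum_k pullback pi w (a k) * e k = 0 -> forall k, a k = 0.
Proof.
move=> a0 k; pose b k := repr (a k) : local_fun (pi w).
have ab j : a j = germ (b j) by rewrite /germ /b reprK.
have /span_sum[N [oN Nw N0]] : \sum_k pullback pi w (germ (b k)) * e k = germ 0.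
  by rewrite rmorph0 -[RHS]a0; apply: eq_bigr => j _; rewrite -ab.
have /choice[G GP] j : exists G, [/\ open G, G (pr w) & reg G (b j)].
  by have /regular_atP[G [oG Gw] br] := valP (b j); exists G.
have [U [Q [oU Uw PQ Qw QN]]] := (oN : cover_open N) w Nw.
pose U' := U `&` [set y | forall j, G j y].
have oU' : open U'.
  by apply: openI => //; apply: open_forall => j; have [] := GP j.
have U'w : U' (pr w) by split=> // j; have [] := GP j.
have br j : reg U' (b j).
  by have [oG _ br] := GP j; apply: reg_restr br => // y [_]; exact.
have Q' : poly_fun U' Q by apply: poly_fun_restr PQ => // y [].
have := domain oU' (ex_intro _ _ U'w)
  (@normal_form_poly_fun K V f l U' (fun j => b j) oU' br) Q'.
case=> [w' [Uw' _]|b0|Q0]; last by move: Qw; rewrite Q0 ?eqxx.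
  have [->|Qw'] := eqVneq (Q w') 0; first by rewrite mulr0.
  by rewrite N0 ?mul0r //; exact: QN.
rewrite ab; apply/germ_eq0; exists U'; split=> // y U'y.
apply: (@fibre_coef_eq0 _ _ f l l_gt0 l_unit f0 y (fun j => b j y)) => w' wy.
by rewrite -wy b0 // wy.
Qed.

Let span1 : span 1.
Proof.
rewrite -(rmorph1 germ); apply/span_germ; exists setT, (fun=> 1).
split=> //; [exact: openT|by apply: poly_fun_cst; exact: openT|].
by exists setT; split=> //; exact: openT.
Qed.

Let spanM b c : span b -> span c -> span (b * c).
Proof.
have [g ->] : exists g : local_fun w, b = germ g by exists (repr b); rewrite /germ reprK.
have [h ->] : exists g : local_fun w, c = germ g by exists (repr c); rewrite /germ reprK.
move=> /span_germ[U [P [oU Uw PP [N [oN Nw gP]]]]].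
move=> /span_germ[U' [Q [oU' Uw' PQ [N' [oN' Nw' hQ]]]]].
have oUU : open (U `&` U') by exact: openI.
rewrite -rmorphM; apply/span_germ; exists (U `&` U'), (fun w => P w * Q w).
split=> //.
  by apply: poly_fun_mul; [apply: poly_fun_restr PP | apply: poly_fun_restr PQ] => // v [].
exists (N `&` N'); split=> //; first exact: openI.
by move=> w' [? ?]; rewrite lfunM gP // hQ.
Qed.

Let span_denominator b : exists c c', [/\ span c, c * c' = 1 & span (c * b)].
Proof.
have [g ->] : exists g : local_fun w, b = germ g by exists (repr b); rewrite /germ reprK.
have [U [P [Q [oU Uw PP PQ [Qw [N [oN Nw NE]]]]]]] := local_fun_quot g.
have [q qE] := cover_lfun oU Uw PQ.
have [q' q'E] := cover_lfun_quot oU Uw (@poly_fun_cst _ _ f l U 1 oU) PQ Qw.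
exists (germ q), (germ q'); split.
- by apply/span_germ; exists U, Q; split=> //; exists N; split.
- rewrite -rmorphM -(rmorph1 germ); apply/germ_eq; exists N; split=> // w' /NE[_ Qw' _].
  by rewrite lfunM lfun1 qE q'E mulrC divfK.
- rewrite -rmorphM; apply/span_germ; exists U, P; split=> //.
  exists N; split=> // w' /NE[_ Qw' gE].
  by rewrite lfunM qE gE mulrC divfK.
Qed.

Lemma cover_flat : flat (pullback pi w).
Proof. exact: flat_of_localized_basis e_free span1 spanM span_denominator. Qed.

(** The derivative l t^(l-1) of t^l - f does not vanish, as [l] and [f] are
    invertible. *)
Lemma cover_unramified : unramified_at pi w.
Proof.
move=> _ [g g0 ->].
have [U [P [Q [oU Uw PP PQ [Qw [N [oN Nw NE]]]]]]] := local_fun_quot g.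
have [p [pr_ pE]] := poly_fun_normal_form l_gt0 f_reg oU PP.
pose v0 := pr w; pose t0 := rt w.
(* g = P / Q with P = \sum_k p_k t^k.  Modulo the functions p_k - p_k(v0) of the
   maximal ideal downstairs, P is a polynomial in t with constant coefficients
   vanishing at t0, hence a multiple of t - t0; and t - t0 generates the same
   ideal as f - f(v0), up to the unit H. *)
have [s sE] : exists s : {poly K}, forall t, \sum_k p k v0 * t ^+ k = s.[t] * (t - t0).
  pose pp := \poly_(i < l) (if insub i is Some j then p j v0 else 0).
  have ppE t : pp.[t] = \sum_k p k v0 * t ^+ k.
    rewrite horner_poly; apply: eq_bigr => i _.
    by rewrite insubT //= => li; congr (p _ _ * _); exact: val_inj.
  have /factor_theorem[s ppS] : root pp t0.
    rewrite rootE ppE -pE //; have [_ _ gE] := NE w Nw.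
    by have : P w = g w * Q w; [rewrite gE divfK | rewrite g0 mul0r => ->].
  by exists s => t; rewrite -ppE ppS hornerM hornerXsubC.
pose H (w' : W) := \sum_(i < l) rt w' ^+ (l.-1 - i) * t0 ^+ i.
have HE w' : (rt w' - t0) * H w' = f (pr w') - f v0.
  by rewrite /H -cover_rootX -[f v0](cover_rootX w) [RHS]subrXX.
have Hw : H w != 0.
  rewrite /H (eq_bigr (fun=> t0 ^+ l.-1)) => [|i _].
    rewrite sumr_const card_ord -mulr_natl mulf_neq0 // expf_neq0 //.
    exact: cover_root_neq0.
  by rewrite -exprD subnK // -ltnS prednK.
have PH : poly_fun U H.
  apply: poly_fun_sum => // i; apply: poly_fun_mul; last exact: poly_fun_cst.
  by apply: poly_fun_exp => //; exact: poly_fun_root.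
have PS : poly_fun U (fun w' => s.[rt w']).
  under eq_fun do rewrite horner_coef.
  apply: poly_fun_sum => // i; apply: poly_fun_mul; first exact: poly_fun_cst.
  by apply: poly_fun_exp => //; exact: poly_fun_root.
have PQH : poly_fun U (fun w' => Q w' * H w') by exact: poly_fun_mul.
have [c0 c0E] := cover_lfun_quot oU Uw PS PQH (mulf_neq0 Qw Hw).
have /choice[c cE] (k : 'I_l) : exists c : local_fun w, forall w', c w' = rt w' ^+ k / Q w'.
  by apply: (cover_lfun_quot oU Uw _ PQ Qw); apply: poly_fun_exp => //; exact: poly_fun_root.
have /choice[a aE] (k : 'I_l) : exists a : local_fun (pi w), forall y, a y = p k y - p k v0.
  by exists (lfun_of oU (Uw : U (pi w)) (reg_sub oU (pr_ k) (reg_cst (p k v0) oU))).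
have [a0 a0E] : exists a : local_fun (pi w), forall y, a y = f y - f v0.
  by exists (lfun_of openT (I : setT (pi w)) (reg_sub openT f_reg (reg_cst (f v0) openT))).
exists l.+1, (fun i => germ (if unlift ord0 i is Some k then c k else c0)),
  (fun i => germ (if unlift ord0 i is Some k then a k else a0)).
split=> [i|].
  case: unliftP => [k _|_]; [exists (a k) => //|exists a0 => //].
    by rewrite aE subrr.
  by rewrite a0E subrr.
rewrite big_ord_recl unlift_none pullback_germ -rmorphM.
rewrite (eq_bigr (fun k => germ (c k * lfun_comp (a k)))) => [|k _]; last first.
  by rewrite liftK pullback_germ -rmorphM.
rewrite -rmorph_sum -rmorphD; apply/germ_eq.
exists (N `&` [set w' | U (pr w') /\ H w' != 0]); split=> //.
  by apply: openI => //; exact: basic_open.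
move=> w' [/NE[Uw' Qw' ->] [_ Hw']].
rewrite lfunD lfunM c0E /= a0E -[X in _ = _ + X]/(lfun_eval w' _) rmorph_sum.
rewrite (eq_bigr (fun k => (p k (pr w') * rt w' ^+ k - p k v0 * rt w' ^+ k) / Q w')).
  rewrite -mulr_suml sumrB -pE // sE -HE; field; rewrite Qw' Hw' //.
move=> k _; transitivity (c k w' * a k (pr w')); first by [].
by rewrite cE aE; field.
Qed.

End AtPoint.

Lemma cover_etale : etale pi.
Proof. by move=> w; split; [exact: cover_flat | exact: cover_unramified]. Qed.

End CoverEtale.

(** * Extraction of roots *)

Section Roots.
Local Open Scope ring_scope.
Local Open Scope classical_set_scope.
Variables (K : closedFieldType) (V : funSpace K).
Hypotheses (V_variety : variety V) (V_irr : irreducible [set: V]).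
Hypotheses (V_normal : Defs.normal V) (V_sc : simply_connected V).

Let V_affine : locally_affine V := variety_locally_affine V_variety.

Lemma nontrivial_cover (f : V -> K) (l : nat) :
  (1 < l)%N -> l%:R != 0 :> K -> (forall v, f v != 0) ->
  ~ is_isomorphism (cover_map f l).
Proof.
move=> l_gt1 l_unit f0 [psi [/can_inj inj _]].
have l_gt0 := ltnW l_gt1; have [z zP] := prim_root_closed_field l_gt0 l_unit.
have [[v _] _] := V_irr; have [w _] := cover_proj_surj f l_gt0 v.
have := inj (deck zP 1 w) w erefl => /(congr1 (@cover_root K V f l)).
rewrite deck_root expr1 -[RHS]mul1r => /(mulIf (cover_root_neq0 l_gt0 f0 w)) z1.
have := prim_order_dvd zP 1; rewrite z1 expr1 eqxx dvdn1 => /eqP l1.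
by rewrite l1 in l_gt1.
Qed.

(** If [f] had no regular [l]-th root, it would have none in the function field,
    and the covering would be irreducible, finite and étale without being an
    isomorphism. *)
Lemma regular_root (f : V -> K) (l : nat) :
  (1 < l <= 3)%N -> l%:R != 0 :> K -> reg setT f -> (forall v, f v != 0) ->
  exists2 g, reg setT g & forall v, g v ^+ l = f v.
Proof.
move=> l_bounds l_unit fr f0; have l_gt1 : (1 < l)%N by case/andP: l_bounds.
have l_gt0 := ltnW l_gt1.
apply: contrapT => noroot; apply: (nontrivial_cover l_gt1 l_unit f0).
have not_power x (D : idomainType) (e : {rmorphism stalk x -> D}) (z : {fraction D}) :
    bijective e -> z ^+ l != frac_germ e (lfun_of openT I fr).
  move=> [e' eK e'K]; apply/eqP => zf; apply: noroot.
  have [n [d [d0 zE]]] := fraction_repr z.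
  pose p : local_fun x := repr (e' n); pose q : local_fun x := repr (e' d).
  have pE : e (germ p) = n by rewrite /germ reprK e'K.
  have qE : e (germ q) = d by rewrite /germ reprK e'K.
  have /germ_eq[N [oN Nx pqf]] : germ (p ^+ l) = germ (lfun_of openT I fr * q ^+ l).
    apply: (can_inj eK); apply/eqP; rewrite -tofrac_eq; apply/eqP.
    rewrite !rmorphXn rmorphM !rmorphXn /= rmorphM !rmorphXn /= pE qE -zE exprMn zf.
    by rewrite [RHS]rmorphM rmorphXn.
  have /regular_atP[N1 [oN1 N1x] pr] := valP p.
  have /regular_atP[N2 [oN2 N2x] qr] := valP q.
  pose N0 := N `&` (N1 `&` N2).
  have oN12 : open (N1 `&` N2) by exact: openI.
  have oN0 : open N0 by exact: openI.
  apply: (@rational_root _ _ l l_gt0 V_affine V_irr V_normal f N0 p q) => //.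
  - by apply: reg_restr pr => // y [_ []].
  - by apply: reg_restr qr => // y [_ []].
  - apply: contrapT => q0; move/eqP: d0; apply; rewrite -qE.
    suff -> : germ q = 0 by rewrite rmorph0.
    apply/germ_eq0; exists N0; split=> // y N0y; apply/eqP; apply: contraT => qy.
    by case: q0; exists y.
  - move=> y [Ny _]; have := pqf y Ny.
    by rewrite -[LHS]/(lfun_eval y _) -[RHS]/(lfun_eval y _) rmorphM !rmorphXn.
have domain : forall (U : set V) (P Q : root_cover f l -> K),
    open U -> U !=set0 -> poly_fun U P -> poly_fun U Q ->
    (forall w, U (cover_proj w) -> P w * Q w = 0) ->
    (forall w, U (cover_proj w) -> P w = 0) \/ (forall w, U (cover_proj w) -> Q w = 0).
  move=> U P Q oU [x Ux]; have [D [e [e_bij _]]] := V_normal x.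
  apply: (poly_fun_domain l_bounds l_unit f0 V_affine V_irr (bij_inj e_bij) _ oU Ux).
  by move=> z; exact: not_power.
apply: V_sc.
- exact: cover_variety.
- exact: cover_irreducible.
- have [z zP] := prim_root_closed_field l_gt0 l_unit.
  exact: (cover_finite l_gt0 l_unit fr f0 V_affine zP).
- exact: cover_etale.
Qed.

End Roots.

(** * Invertible functions are not infinitely divisible *)

Section FunctionFieldOfVariety.
Local Open Scope ring_scope.
Local Open Scope classical_set_scope.
Variables (K : closedFieldType) (V : funSpace K) (x : V).
Hypotheses (V_affine : locally_affine V) (V_irr : irreducible [set: V]).
Variables (D : idomainType) (e : {rmorphism stalk x -> D}).
Hypothesis e_bij : bijective e.

Definition cst_lfun (c : K) : local_fun x := LocalFun (regular_at_cst x c).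
Fact cst_lfun_zmod : zmod_morphism cst_lfun.
Proof. by move=> c d; apply/val_inj/funext. Qed.
Fact cst_lfun_monoid : monoid_morphism cst_lfun.
Proof. by split=> [|c d]; apply/val_inj/funext. Qed.
HB.instance Definition _ := GRing.isZmodMorphism.Build _ _ cst_lfun cst_lfun_zmod.
HB.instance Definition _ := GRing.isMonoidMorphism.Build _ _ cst_lfun cst_lfun_monoid.

(** The generators are the coordinates of an affine chart around [x], since a
    germ is a quotient of polynomials in them. *)
Lemma function_field_generated : exists xs : seq {fraction D},
  forall S : {fraction D} -> Prop, divring_closed [pred y | `[< S y >]] ->
    (forall c, S (frac_germ e (cst_lfun c))) -> (forall y, y \in xs -> S y) ->
    forall y, S y.
Proof.
have [U Ux [oU [n [phi chartU]]]] := V_affine x.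
pose lpoly p : local_fun x := lfun_of oU Ux (chart_poly_reg chartU p).
exists [seq frac_germ e (lpoly 'X_i) | i : 'I_n] => S [S1 SB SV] Sc Sx.
have S_1 : S 1 by move/asboolP: S1.
have S_B y z : S y -> S z -> S (y - z).
  by move=> Sy Sz; apply/asboolP; apply: SB; exact/asboolP.
have S_V y z : S y -> S z -> S (y / z).
  by move=> Sy Sz; apply/asboolP; apply: SV; exact/asboolP.
have S_0 : S 0 by rewrite -(subrr 1); exact: S_B.
have S_D y z : S y -> S z -> S (y + z).
  by move=> Sy Sz; rewrite -[z]opprK -[- z]sub0r; exact: (S_B _ _ Sy (S_B _ _ S_0 Sz)).
have S_M y z : S y -> S z -> S (y * z).
  by move=> Sy Sz; rewrite -[z]invrK -[z^-1]div1r; exact: (S_V _ _ Sy (S_V _ _ S_1 Sz)).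
have Sp p : S (frac_germ e (lpoly p)).
  have -> : lpoly p = \sum_(m <- msupp p) cst_lfun p@_m * \prod_i lpoly 'X_i ^+ m i.
    apply/val_inj/funext => y; rewrite -[RHS]/(lfun_eval y _) rmorph_sum.
    rewrite [LHS]mevalE; apply: eq_bigr => m _; rewrite rmorphM rmorph_prod.
    congr (_ * _); apply: eq_bigr => i _; rewrite rmorphXn; congr (_ ^+ _).
    by rewrite /lfun_eval /= mevalXU.
  rewrite rmorph_sum; apply: (big_ind S) => // m _; rewrite (rmorphM (frac_germ e)).
  apply: (S_M); first exact: Sc.
  rewrite (rmorph_prod (frac_germ e)); apply: (big_ind S) => // i _.
  rewrite (rmorphXn (frac_germ e)); elim: (m i) => [|k IH]; first by rewrite expr0.
  rewrite exprS; apply: (S_M) => //; apply: Sx; apply/mapP; exists i => //.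
  by rewrite mem_enum.
have Sg (g : local_fun x) : S (frac_germ e g).
  have /regular_atP[N [oN Nx] gr] := valP g.
  have [p [q [qx gE]]] := chart_reg oU chartU oN gr Ux Nx.
  have q0 : frac_germ e (lpoly q) != 0.
    apply/eqP => /(frac_germ_eq0 (bij_inj e_bij))[M [oM Mx q0]].
    by move: qx; rewrite -[_.@[_]]/(lpoly q x) q0 ?eqxx.
  suff -> : frac_germ e g = frac_germ e (lpoly p) / frac_germ e (lpoly q) by exact: S_V.
  apply: (mulIf q0); rewrite divfK // -rmorphM; congr (tofrac (e _)).
  apply/germ_eq; exists (U `&` [set y | q.@[phi y] != 0]); split=> //.
    exact: (chart_open chartU).
  by move=> y [Uy qy]; have [_ gy] := gE y Uy qy; rewrite lfunM gy /= divfK.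
have [e' eK e'K] := e_bij.
have Sd (d : D) : S (tofrac d).
  have -> : tofrac d = frac_germ e (repr (e' d)) by rewrite /frac_germ /= /germ reprK e'K.
  exact: Sg.
move=> y; have [a [d [d0 yE]]] := fraction_repr y.
have -> : y = tofrac a / tofrac d by rewrite -yE mulfK // tofrac_eq0.
exact: S_V.
Qed.

Lemma frac_germ_constant (f : V -> K) (fr : reg setT f) (c : K) :
  frac_germ e (lfun_of openT I fr) = frac_germ e (cst_lfun c) -> forall v, f v = c.
Proof.
move=> /eqP; rewrite tofrac_eq => /eqP/(bij_inj e_bij)/germ_eq[N [oN Nx fc]] v.
apply: (reg_eq_dense V_affine V_irr (f := f) (g := fun=> c) openT oN) => //.
- by apply: reg_cst; exact: openT.
- by exists x.
- by move=> y _ /fc.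
Qed.

End FunctionFieldOfVariety.

Section Divisibility.
Local Open Scope ring_scope.
Local Open Scope classical_set_scope.

Lemma mul_to_addX (F : fieldType) (v : F -> int) x k :
  mul_to_add v -> x != 0 -> v (x ^+ k) = v x *+ k.
Proof.
move=> vM x0; elim: k => [|k IH]; last by rewrite exprS vM ?expf_neq0 // IH mulrS.
by apply: (addrI (v 1)); rewrite addr0 -[in LHS]vM ?oner_neq0 // mulr1.
Qed.

Lemma small_unit_root (K : fieldType) : exists l, (1 < l <= 3)%N /\ l%:R != 0 :> K.
Proof.
have [two0|] := eqVneq (2%:R : K) 0; last by exists 2%N.
by exists 3%N; split=> //; rewrite -[3%N]addn1 natrD two0 add0r oner_neq0.
Qed.

Variables (K : closedFieldType) (V : funSpace K).
Hypotheses (V_variety : variety V) (V_irr : irreducible [set: V]).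
Hypotheses (V_normal : Defs.normal V) (V_sc : simply_connected V).

(** Infinite descent on the absolute value of v, which [regular_root] divides by
    [l]. *)
Lemma invertible_constant (f : V -> K) : reg setT f -> (forall v, f v != 0) ->
  constant_function f.
Proof.
move=> fr f0; apply: contrapT => fnc.
have V_affine := variety_locally_affine V_variety.
have [[x _] _] := V_irr; have [D [e [e_bij _]]] := V_normal x.
pose rho g (gr : reg setT g) := frac_germ e (lfun_of (openT : open setT) (I : setT x) gr).
have [xs xsP] := function_field_generated V_affine e_bij.
have [|v vM vf] := @function_field_hom K _ (frac_germ e \o @cst_lfun K V x) xs (rho f fr) xsP.
  move=> c; apply/eqP => fc; apply: fnc; exists c.
  exact: (frac_germ_constant V_affine V_irr e_bij fc).
have [l [l_bounds l_unit]] := small_unit_root K.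
have rho0 g gr : (forall y, g y != 0) -> rho g gr != 0.
  move=> g0; apply/eqP => /(frac_germ_eq0 (bij_inj e_bij))[N [_ Nx N0]].
  by move/eqP: (N0 x Nx); apply/negP; exact: g0.
have v0 n : forall g gr, (forall y, g y != 0) -> (`|v (rho g gr)| <= n)%N ->
    v (rho g gr) = 0.
  elim: n => [|n IH] g gr g0; first by rewrite leqn0 absz_eq0 => /eqP.
  have [h hr hg] := regular_root V_variety V_irr V_normal V_sc l_bounds l_unit gr g0.
  have h0 y : h y != 0.
    apply: contraNneq (g0 y) => h0; rewrite -hg h0 expr0n.
    by case: l l_bounds {l_unit hg} => [].
  have -> : rho g gr = rho h hr ^+ l.
    rewrite /rho -rmorphXn; congr (tofrac (e (germ _))); apply/val_inj/funext => y.
    by rewrite -[RHS]/(lfun_eval y _) rmorphXn /= -hg.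
  rewrite mul_to_addX ?rho0 // -mulr_natr abszM natz absz_nat => small.
  rewrite (IH h hr h0) ?mul0r //; case/andP: l_bounds => l_gt1 _.
  rewrite leqNgt; apply/negP => big; move: small; apply/negP; rewrite -ltnNge.
  by apply: leq_trans (leq_mul big l_gt1); rewrite muln2 doubleS !ltnS -addnn leq_addr.
by move/eqP: vf; apply; exact: (v0 _ f fr f0 (leqnn _)).
Qed.

End Divisibility.

Theorem theorem3 (K : closedFieldType) (V : funSpace K)
    (V_variety : variety V) (V_irreducible : irreducible [set: V]%classic)
    (V_normal : normal V) (V_simply_connected : simply_connected V)
    (char0_or_Cl0 : [pchar K]%R =i pred0 \/ trivial_class_group V)
    (f : V -> K) (f_invertible : invertible_regular f) :
  constant_function f.
Proof.
case: f_invertible => f_reg [g _ fg].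
apply: (invertible_constant V_variety V_irreducible V_normal V_simply_connected) => // v.
by apply/eqP => f0; have /eqP := fg v; rewrite f0 mul0r eq_sym oner_eq0.
Qed.
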